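(* Let $\Omega\subset\mathbb C^m$ be a bounded domain and let $\Omega^*=\{\bar z: z\in\Omega\}$. Let $\boldsymbol T=(T_1,\ldots,T_m)$ be a commuting $m$-tuple of bounded operators belonging to the Cowen-Douglas class $B_1(\Omega^* )$. Then the curvature matrix $\mathsf K_{\boldsymbol T}(w)$ is negative definite for each $w\in\Omega^*$.
   Context: Let $D$ be a bounded domain in $\mathbb C^m$. A commuting tuple $\boldsymbol T=(T_1,\ldots,T_m)$ of bounded linear operators on a separable complex Hilbert space $\mathcal H$ belongs to $B_1(D)$ if, writing $D_{\boldsymbol T-w}:\mathcal H\to\mathcal H\oplus\cdots\oplus\mathcal H$ for the operator $x\mapsto((T_1-w_1)x,\ldots,(T_m-w_m)x)$, the range of $D_{\boldsymbol T-w}$ is closed and $\dim\ker D_{\boldsymbol T-w}=1$ for all $w\in D$, and the span of $\{\ker D_{\boldsymbol T-w}:w\in D\}$ is dense in $\mathcal H$. Such a tuple determines a holomorphic Hermitian line bundle $E_{\boldsymbol T}=\{(w,x)\in D\times\mathcal H: x\in\ker D_{\boldsymbol T-w}\}$ over $D$. If $\gamma$ is a non-vanishing holomorphic section of $E_{\boldsymbol T}$ on an open set $D_0\subseteq D$ (i.e. a holomorphic map $\gamma:D_0\to\mathcal H$ with $0\ne\gamma(w)\in\ker D_{\boldsymbol T-w}$), the curvature matrix is $$\mathsf K_{\boldsymbol T}(w)=\Big(-\frac{\partial^2\log\|\gamma(w)\|^2}{\partial w_i\,\partial\bar w_j}\Big)_{i,j=1}^m,\qquad w\in D_0,$$ and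 it does not depend on the choice of $\gamma$. *)

(* Defs.v *)
From HB Require Import structures.
From mathcomp Require Import all_boot all_order all_algebra.
From mathcomp Require Import complex.
From mathcomp Require Import all_classical all_reals all_analysis.
Set Implicit Arguments.
Unset Strict Implicit.
Unset Printing Implicit Defensive.
Import Order.TTheory GRing.Theory Num.Theory.
Import numFieldNormedType.Exports.
Local Open Scope classical_set_scope.
Local Open Scope ring_scope.
Local Open Scope complex_scope.
Local Open Scope sesquilinear_scope.

(* R[i] with the topology, norm and module structure over itself that the
   library gives to an abstract numClosedFieldType. *)
HB.instance Definition _ (R : realType) :=
  PseudoPointedMetric.copy R[i] (R[i])^o.
HB.instance Definition _ (R : realType) := GRing.ComAlgebra.copy R[i] (R[i])^o.
HB.instance Definition _ (R : realType) := Vector.copy R[i] (R[i])^o.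
HB.instance Definition _ (R : realType) := NormedModule.copy R[i] (R[i])^o.

Section Operators.
Context {R : realType}.
Local Notation C := R[i].

Definition bounded_domain (m : nat) (D : set 'rV[C]_m) : Prop :=
  [/\ open D, connected D, D !=set0 & bounded_set D].

Definition conj_set (m : nat) (D : set 'rV[C]_m) : set 'rV[C]_m :=
  [set z ^ Num.conj | z in D].

Definition separable (H : topologicalType) : Prop :=
  exists2 S : set H, countable S & dense S.

(* [dot] is linear in its first argument and induces the norm of [H]. *)
Definition inner_product (H : normedModType C) (dot : {dot H for Num.conj}) :
  Prop := forall x : H, `|x| ^+ 2 = dot x x.

Definition bounded_operator (H : normedModType C) (T : {linear H -> H}) :
  Prop := exists M : C, forall x, `|T x| <= M * `|x|.

Definition commuting_tuple (H : lmodType C) (m : nat)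
    (T : 'I_m -> {linear H -> H}) : Prop :=
  forall i j x, T i (T j x) = T j (T i x).

Definition lin_span (H : lmodType C) (A : set H) : set H :=
  [set x | exists (n : nat) (c : 'I_n -> C) (v : 'I_n -> H),
     (forall k, A (v k)) /\ x = \sum_k c k *: v k].

Definition dim_one (H : lmodType C) (A : set H) : Prop :=
  exists2 x : H, x != 0 & A = [set c *: x | c in [set: C]].

(* H (+) ... (+) H is 'rV[H]_m, whose topology is the product topology. *)
Definition Dop (H : lmodType C) (m : nat) (T : 'I_m -> {linear H -> H})
    (w : 'rV[C]_m) (x : H) : 'rV[H]_m :=
  \row_i (T i x - w 0 i *: x).

Definition kerD (H : lmodType C) (m : nat) (T : 'I_m -> {linear H -> H})
    (w : 'rV[C]_m) : set H :=
  [set x | Dop T w x = 0].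

Record cowen_douglas1 (H : normedModType C) (m : nat) (D : set 'rV[C]_m)
    (T : 'I_m -> {linear H -> H}) : Prop := CowenDouglas1 {
  cd_bounded : forall i, bounded_operator (T i) ;
  cd_commute : commuting_tuple T ;
  cd_closed : forall w, D w -> closed (range (Dop T w)) ;
  cd_dim1 : forall w, D w -> dim_one (kerD T w) ;
  cd_dense : dense (lin_span (\bigcup_(w in D) kerD T w)) }.

(* Complex Frechet differentiability on the open set [D0] is holomorphy. *)
Record holomorphic_section (H : normedModType C) (m : nat)
    (D : set 'rV[C]_m) (T : 'I_m -> {linear H -> H})
    (D0 : set 'rV[C]_m) (gamma : 'rV[C]_m -> H) : Prop := HolomorphicSection {
  hs_open : open D0 ;
  hs_sub : D0 `<=` D ;
  hs_holo : forall w, D0 w -> differentiable gamma w ;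
  hs_neq0 : forall w, D0 w -> gamma w != 0 ;
  hs_ker : forall w, D0 w -> kerD T w (gamma w) }.

End Operators.

Section Curvature.
Context {R : realType}.
Local Notation C := R[i].

(* The derivative d/dt f (z + t v) at t = 0 over real t, taken on real and
   imaginary parts; ['D_v f] would take the limit over complex t. *)
Definition real_derive (m : nat) (f : 'rV[C]_m -> C) (v z : 'rV[C]_m) : C :=
  derive1 (fun t : R => complex.Re (f (z + t%:C *: v))) 0 +i*
  derive1 (fun t : R => complex.Im (f (z + t%:C *: v))) 0.

(* d/dz_j = (d/dx_j - i d/dy_j) / 2 and d/dzbar_j = (d/dx_j + i d/dy_j) / 2 *)
Definition dz (m : nat) (j : 'I_m) (f : 'rV[C]_m -> C) (z : 'rV[C]_m) : C :=
  (real_derive f 'e_j z - 'i * real_derive f ('i *: 'e_j) z) / 2.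

Definition dzbar (m : nat) (j : 'I_m) (f : 'rV[C]_m -> C) (z : 'rV[C]_m) : C :=
  (real_derive f 'e_j z + 'i * real_derive f ('i *: 'e_j) z) / 2.

(* The norm of a normed module over [C] takes values in [C]. *)
Definition log_sqnorm (H : normedModType C) (m : nat) (gamma : 'rV[C]_m -> H)
    (z : 'rV[C]_m) : C :=
  (ln (complex.Re `|gamma z| ^+ 2))%:C.

Definition section_curvature (H : normedModType C) (m : nat)
    (gamma : 'rV[C]_m -> H) (w : 'rV[C]_m) : 'M[C]_m :=
  \matrix_(i, j) - dz i (dzbar j (log_sqnorm gamma)) w.

(* The curvature at [w] computed from some holomorphic section defined around
   [w]. If there were none, it would be 0, which is not negative definite for
   0 < m. *)
Definition curvature (H : normedModType C) (m : nat) (D : set 'rV[C]_m)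
    (T : 'I_m -> {linear H -> H}) (w : 'rV[C]_m) : 'M[C]_m :=
  xget 0 [set K | exists (D0 : set 'rV[C]_m) (gamma : 'rV[C]_m -> H),
    [/\ holomorphic_section D T D0 gamma, D0 w & K = section_curvature gamma w]].

(* On R[i], [x < 0] means that [x] is real and negative. *)
Definition negative_definite (m : nat) (K : 'M[C]_m) : Prop :=
  K \is hermsymmx /\
  forall v : 'rV[C]_m, v != 0 -> (v *m K *m v ^t Num.conj) 0 0 < 0.

End Curvature.

(* Main.v *)
Require Import Defs.
From HB Require Import structures.
From mathcomp Require Import all_boot all_order all_algebra.
From mathcomp Require Import complex ring lra.
From mathcomp Require Import all_classical all_reals all_analysis.
Set Implicit Arguments.
Unset Strict Implicit.
Unset Printing Implicit Defensive.
Import Order.TTheory GRing.Theory Num.Theory.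
Import numFieldNormedType.Exports.
Local Open Scope classical_set_scope.
Local Open Scope ring_scope.
Local Open Scope complex_scope.

(** Let g be a non-vanishing holomorphic section of the bundle of joint
    eigenvectors, g_i its partial derivatives and N = |g|^2.  Differentiating
    log N twice gives the curvature matrix
      K_ij = - (<g_i, g_j> N - <g_i, g> <g, g_j>) / N^2,
    so for u = sum_i v_i g_i the form v K v^* is - (|u|^2 |g|^2 - |<u, g>|^2) / N^2,
    the defect in the Cauchy-Schwarz inequality for u and g with a minus sign
    ([quadratic_form]).  It is strictly negative unless u is a multiple of g.
    Differentiating (T_k - z_k) g(z) = 0 in the direction v gives
    (T_k - w_k) u = v_k g ([derivative_eigen]); if u = a g, the left-hand side
    is zero, so every v_k is zero.

    Two facts of analysis have to be added.

    Holomorphy means here complex differentiability, and the formula for K needs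
    the derivatives g_j to be differentiable again.  This is Goursat's theorem.
    It is proved for scalar functions on squares ([goursat]) and gives, through
    a form of Cauchy's integral formula, |f(a)| <= 4 max |f| over the boundary of
    a square centred at a ([weak_max_principle]).  Applied to powers of f, the
    constant 4 disappears and finitely many exceptional points are allowed
    ([max_principle]).  The maximum principle for difference quotients bounds
    first, second and mixed second divided differences of f by its maximum
    ([cauchy_lipschitz], [cauchy_divided_lipschitz], [mixed_difference]).  By
    duality the last bound holds for maps into a Hilbert space, and it says that
    the difference quotients of g_j form a Cauchy family; completeness then gives
    the second derivative ([second_derivative]).

    A holomorphic section has to exist near each point w of the domain, since
    otherwise the curvature would be a default value.  Fix an eigenvector e at w
    and normalise the eigenvectors x near w by <x, e> = 1.  The range of T - z is
    closed and its kernel is a line not orthogonal to e (for z near w), so a Baire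
    category argument shows that
    T - z is bounded below on the orthogonal complement of e ([bounded_below]).
    As (T - z) x = (z' - z) x for an eigenvector x at z', this bound shows that the
    normalised eigenvector g(z') is a Lipschitz function of z'.  It is even
    differentiable: the candidate partial derivatives d_j are the solutions of
    (T_i - z_i) d_j = delta_ij g(z), which exist because the right-hand side is a
    limit of elements of the closed range, and the bound from below controls the
    remainder quadratically ([holomorphic_section_through]). *)

(** * The norm of a complex normed module as a real number *)

Section RealNorm.
Context {R : realType}.
Local Notation C := R[i].

(** The norm of a normed module over R[i] is an element of R[i]; its real part
    lives in an ordered field, where linear arithmetic applies. *)
Definition nrm (V : normedModType C) (x : V) : R := complex.Re `|x|.

Lemma nrmE (V : normedModType C) (x : V) : `|x| = (nrm x)%:C.
Proof. by rewrite /nrm RRe_real // normr_real. Qed.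

Lemma nrm_ge0 (V : normedModType C) (x : V) : 0 <= nrm x.
Proof. by rewrite -ler0c -nrmE. Qed.

Lemma nrm0 (V : normedModType C) : nrm (0 : V) = 0.
Proof. by rewrite /nrm normr0. Qed.

Lemma nrm_eq0 (V : normedModType C) (x : V) : nrm x = 0 -> x = 0.
Proof. by move=> h; apply/normr0_eq0; rewrite nrmE h. Qed.

Lemma nrm_gt0 (V : normedModType C) (x : V) : x != 0 -> 0 < nrm x.
Proof.
move=> h; rewrite lt_neqAle nrm_ge0 andbT eq_sym; apply: contra h => /eqP h.
by apply/eqP/nrm_eq0.
Qed.

Lemma nrmD (V : normedModType C) (x y : V) : nrm (x + y) <= nrm x + nrm y.
Proof. by rewrite -lecR rmorphD /= -!nrmE ler_normD. Qed.

Lemma nrmN (V : normedModType C) (x : V) : nrm (- x) = nrm x.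
Proof. by rewrite /nrm normrN. Qed.

Lemma nrmBC (V : normedModType C) (x y : V) : nrm (x - y) = nrm (y - x).
Proof. by rewrite -nrmN opprB. Qed.

Lemma nrmB (V : normedModType C) (x y : V) : nrm (x - y) <= nrm x + nrm y.
Proof. by rewrite -(nrmN y) nrmD. Qed.

Lemma nrmZ (V : normedModType C) (a : C) (x : V) :
  nrm (a *: x) = nrm a * nrm x.
Proof. by apply: complexI; rewrite rmorphM /= -!nrmE normrZ. Qed.

Lemma nrmM (a b : C) : nrm (a * b) = nrm a * nrm b.
Proof. by rewrite -nrmZ. Qed.

Lemma nrmV (a : C) : nrm a^-1 = (nrm a)^-1.
Proof. by apply: complexI; rewrite fmorphV /= -!nrmE normfV. Qed.

Lemma nrmR (r : R) : nrm (r%:C) = `|r|.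
Proof.
by rewrite /nrm normc_def /= expr0n /= addr0 sqrtr_sqr.
Qed.

Lemma nrm_sub (V : normedModType C) (x y z : V) :
  nrm (x - z) <= nrm (x - y) + nrm (y - z).
Proof. by rewrite (le_trans _ (nrmD _ _)) // addrA subrK. Qed.

Lemma nrm_sum (V : normedModType C) I (s : seq I) (P : pred I) (F : I -> V) :
  nrm (\sum_(i <- s | P i) F i) <= \sum_(i <- s | P i) nrm (F i).
Proof.
elim/big_ind2: _ => [|x a y b hx hy|//]; first by rewrite nrm0.
by rewrite (le_trans (nrmD _ _)) // lerD.
Qed.

Lemma nbhs_nrmP (V : normedModType C) (x : V) (A : set V) :
  nbhs x A <-> exists2 e : R, 0 < e & forall y, nrm (y - x) < e -> A y.
Proof.
split.
  move/nbhs_normP => [e /= e0 sub]; have := gtr0_real e0.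
  move=> /complex_realP [r er]; subst e; exists r; first by rewrite -ltcR.
  by move=> y yr; apply: sub; rewrite /= distrC nrmE ltcR.
move=> [e e0 sub]; apply/nbhs_normP; exists e%:C; rewrite /= ?ltcR //.
by move=> y; rewrite /= distrC nrmE ltcR; apply: sub.
Qed.

Lemma cvg_nrmP (V : normedModType C) T (F : set_system T) (FF : Filter F)
    (f : T -> V) (l : V) :
  f @ F --> l <-> forall e : R, 0 < e -> \forall x \near F, nrm (f x - l) < e.
Proof.
split=> [h e e0|h A /nbhs_nrmP [e e0 sub]].
  by apply: (h [set y | nrm (y - l) < e]); apply/nbhs_nrmP; exists e.
by apply: filterS (h e e0) => x; apply: sub.
Qed.

Lemma continuous_nrmP (T : topologicalType) (V : normedModType C)
    (f : T -> V) (x : T) :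
  {for x, continuous f} <->
  forall e : R, 0 < e -> \forall y \near x, nrm (f y - f x) < e.
Proof. exact: cvg_nrmP. Qed.

Lemma continuous_epsP (U V : normedModType C) (f : U -> V) (x : U) :
  {for x, continuous f} <->
  forall e : R, 0 < e -> exists2 d : R, 0 < d &
    forall y, nrm (y - x) < d -> nrm (f y - f x) < e.
Proof.
split=> [/continuous_nrmP H e /H /nbhs_nrmP //|H].
by apply/continuous_nrmP => e /H h; apply/nbhs_nrmP.
Qed.

Lemma nbhsRP (x : R) (A : set R) :
  nbhs x A <-> exists2 e : R, 0 < e & forall y, `|y - x| < e -> A y.
Proof.
split=> [/nbhs_normP [e /= e0 sub]|[e e0 sub]].
  by exists e => // y ye; apply: sub; rewrite /= distrC.
by apply/nbhs_normP; exists e => //= y; rewrite /= distrC; apply: sub.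
Qed.

Lemma dnbhsRP (x : R) (A : set R) :
  x^' A <-> exists2 e : R, 0 < e & forall y, y != x -> `|y - x| < e -> A y.
Proof.
split=> [/nbhsRP [e e0 sub]|[e e0 sub]].
  by exists e => // y yx yxe; apply: sub.
by apply/nbhsRP; exists e => // y ye yx; apply: sub.
Qed.

Lemma dnbhs_nrmP (V : normedModType C) (x : V) (A : set V) :
  x^' A <-> exists2 e : R, 0 < e & forall y, y != x -> nrm (y - x) < e -> A y.
Proof.
split=> [/nbhs_nrmP [e e0 sub]|[e e0 sub]].
  by exists e => // y yx yxe; apply: sub.
by apply/nbhs_nrmP; exists e => // y ye yx; apply: sub.
Qed.

Lemma Re_le_nrm (z : C) : `|complex.Re z| <= nrm z.
Proof.
rewrite /nrm normc_def /= -sqrtr_sqr ler_wsqrtr // lerDl sqr_ge0 //.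
Qed.

Lemma Im_le_nrm (z : C) : `|complex.Im z| <= nrm z.
Proof.
rewrite /nrm normc_def /= -sqrtr_sqr ler_wsqrtr // lerDr sqr_ge0 //.
Qed.

Lemma nrm_le_ReIm (z : C) : nrm z <= `|complex.Re z| + `|complex.Im z|.
Proof.
case: z => a b; rewrite /nrm normc_def /=.
rewrite -[leRHS]ger0_norm ?addr_ge0 // -sqrtr_sqr ler_wsqrtr //.
by rewrite sqrrD !real_normK ?num_real // -addrA lerD2l lerDr mulrn_wge0 // mulr_ge0.
Qed.

Lemma Re_continuous : continuous (@complex.Re R : C -> R).
Proof.
move=> z A /nbhsRP [e e0 sub]; apply/nbhs_nrmP; exists e => // y yz.
apply: sub; apply: le_lt_trans yz; rewrite (le_trans _ (Re_le_nrm _)) //.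
by case: y z => [? ?] [? ?].
Qed.

Lemma Im_continuous : continuous (@complex.Im R : C -> R).
Proof.
move=> z A /nbhsRP [e e0 sub]; apply/nbhs_nrmP; exists e => // y yz.
apply: sub; apply: le_lt_trans yz; rewrite (le_trans _ (Im_le_nrm _)) //.
by case: y z => [? ?] [? ?].
Qed.

Lemma realC_continuous : continuous (fun t : R => t%:C : C).
Proof.
move=> z A /nbhs_nrmP [e e0 sub]; apply/nbhsRP; exists e => // y yz.
by apply: sub; rewrite -rmorphB nrmR.
Qed.

Lemma ReD (x y : C) : complex.Re (x + y) = complex.Re x + complex.Re y.
Proof. by case: x y => [? ?] []. Qed.
Lemma ImD (x y : C) : complex.Im (x + y) = complex.Im x + complex.Im y.
Proof. by case: x y => [? ?] []. Qed.
Lemma ReB (x y : C) : complex.Re (x - y) = complex.Re x - complex.Re y.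
Proof. by case: x y => [? ?] []. Qed.
Lemma ImB (x y : C) : complex.Im (x - y) = complex.Im x - complex.Im y.
Proof. by case: x y => [? ?] []. Qed.
Lemma cReM (x y : C) : complex.Re (x * y) =
  complex.Re x * complex.Re y - complex.Im x * complex.Im y.
Proof. by case: x y => [? ?] []. Qed.
Lemma cImM (x y : C) : complex.Im (x * y) =
  complex.Re x * complex.Im y + complex.Im x * complex.Re y.
Proof. by case: x y => [? ?] [? ?] /=. Qed.

Section PointwiseContinuity.
Variables (T : topologicalType) (x : T).
Implicit Types f g : T -> C.

Lemma cont_cst c : {for x, continuous (fun _ : T => c : C)}.
Proof. exact: cvg_cst. Qed.

Lemma contD f g : {for x, continuous f} -> {for x, continuous g} ->
  {for x, continuous (fun y => f y + g y)}.
Proof. by move=> cf cg; apply: cvgD; [exact: cf|exact: cg]. Qed.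

Lemma contB f g : {for x, continuous f} -> {for x, continuous g} ->
  {for x, continuous (fun y => f y - g y)}.
Proof. by move=> cf cg; apply: cvgB; [exact: cf|exact: cg]. Qed.

Lemma contM f g : {for x, continuous f} -> {for x, continuous g} ->
  {for x, continuous (fun y => f y * g y)}.
Proof. by move=> cf cg; apply: cvgM; [exact: cf|exact: cg]. Qed.

Lemma contV f : f x != 0 -> {for x, continuous f} ->
  {for x, continuous (fun y => (f y)^-1)}.
Proof. by move=> f0 cf; apply: cvgV; [exact: f0|exact: cf]. Qed.

End PointwiseContinuity.

Lemma cont_id (x : C) : {for x, continuous (fun y : C => y)}.
Proof. exact: cvg_id. Qed.

End RealNorm.

(** * Integrals of continuous functions over [0, s] *)

Section RealIntegral.
Context {R : realType}.
Implicit Types (u v U : R -> R) (s t : R).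
Local Notation mu := (@lebesgue_measure R).

Definition rint u s : R := (\int[mu]_(x in `[0%R, s]) u x)%R.

Lemma continuous_integrable u (a b : R) : continuous u ->
  mu.-integrable `[a, b] (EFin \o u).
Proof.
move=> cu; apply: continuous_compact_integrable; first exact: segment_compact.
exact: continuous_subspaceT.
Qed.

(** Newton-Leibniz; the other rules of the calculus of [rint] that involve a
    change of the interval are read off antiderivatives. *)
Lemma rint_antiderivative u U s : 0 < s -> continuous u ->
  (forall x : R, 0 <= x -> is_derive x 1 U (u x)) -> rint u s = U s - U 0.
Proof.
move=> s0 cu dU.
have cU x : 0 <= x -> {for x, continuous U}.
  move=> x0; apply: differentiable_continuous; apply/derivable1_diffP.
  by have := dU x x0.
rewrite /rint /Rintegral (@continuous_FTC2 _ _ U) //.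
- exact: continuous_subspaceT.
- split=> [x||].
  + by rewrite in_itv /= => /andP[x0 _]; have := dU x (ltW x0).
  + exact: cvg_at_right_filter (cU 0 (lexx _)).
  + exact: cvg_at_left_filter (cU s (ltW s0)).
- move=> x; rewrite in_itv /= => /andP[x0 _].
  by rewrite derive1E; have [] := dU x (ltW x0).
Qed.

Lemma antiderivative_exists u : continuous u ->
  exists U, forall x : R, 0 <= x -> is_derive x 1 U (u x).
Proof.
move=> cu; exists (fun x => \int[mu]_(t in `[-1, x]) u t)%R => x x0.
have [||||d1 d2] := @continuous_FTC1_closed R u (-1) x (x + 1).
- by rewrite ltrDl.
- exact: continuous_integrable.
- by rewrite (lt_le_trans _ x0) // ltrN10.
- exact: cu.
by apply: DeriveDef; [exact: d1|rewrite -derive1E; exact: d2].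
Qed.

Lemma rintD u v s : continuous u -> continuous v ->
  rint (fun x => u x + v x) s = rint u s + rint v s.
Proof. by move=> cu cv; apply: RintegralD => //; apply: continuous_integrable. Qed.

Lemma rintZ a u s : continuous u -> rint (fun x => a * u x) s = a * rint u s.
Proof. by move=> cu; apply: RintegralZl => //; apply: continuous_integrable. Qed.

Lemma rint_cst a s : 0 <= s -> rint (fun=> a) s = a * s.
Proof.
move=> s0; rewrite /rint Rintegral_cst //= lebesgue_measure_itv /= lte_fin.
by rewrite le_eqVlt in s0; case/orP: s0 => [/eqP <-|->] /=;
  rewrite ?ltxx ?subr0.
Qed.

Lemma le_rint u v s : continuous u -> continuous v ->
  (forall x, 0 <= x <= s -> u x <= v x) -> rint u s <= rint v s.
Proof.
move=> cu cv uv; apply: le_Rintegral => //; try exact: continuous_integrable.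
Qed.

Lemma rint_bound u b s : 0 <= s -> continuous u ->
  (forall x, 0 <= x <= s -> `|u x| <= b) -> `|rint u s| <= b * s.
Proof.
move=> s0 cu ub; rewrite ler_norml -mulNr -!rint_cst //.
have cc (a : R) : continuous (fun _ : R => a) by move=> x; exact: cvg_cst.
by apply/andP; split; apply: le_rint => // x /ub; rewrite ler_norml => /andP[].
Qed.

Lemma rint_split u s t : 0 < s -> 0 < t -> continuous u ->
  rint u (s + t) = rint u s + rint (fun x => u (s + x)) t.
Proof.
move=> s0 t0 cu; have [U dU] := antiderivative_exists cu.
rewrite (rint_antiderivative (addr_gt0 s0 t0) cu dU) (rint_antiderivative s0 cu dU).
suff -> : rint (fun x => u (s + x)) t = U (s + t) - U (s + 0).
  by rewrite addr0; ring.
apply: (@rint_antiderivative _ (fun x => U (s + x)) t t0).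
- move=> x; apply: (@continuous_comp _ _ _ (fun y => s + y) u); last exact: cu.
  by apply: cvgD; [exact: cvg_cst|exact: cvg_id].
- move=> x x0.
  have dU' : is_derive (s + x) 1 U (u (s + x)).
    by apply: dU; rewrite addr_ge0 // ltW.
  rewrite -[u _]mulr1.
  have dS : is_derive x (1 : R) (fun y : R => s + y) 1.
    have := @is_deriveD R R^o R^o (cst s) id x 1 0 1 (is_derive_cst _ _ _) (is_derive_id _ _).
    by rewrite add0r.
  have := @is_derive1_comp R U (fun y => s + y) x (u (s + x)) 1 dU' dS.
  by rewrite mulr1.
Qed.

End RealIntegral.

(** * Integrals along the boundary of a square *)

Section Goursat.
Context {R : realType}.
Local Notation C := R[i].

Definition cint (h : R -> C) (s : R) : C :=
  rint (fun x => complex.Re (h x)) s +i* rint (fun x => complex.Im (h x)) s.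

Lemma cRe_continuous (h : R -> C) :
  continuous h -> continuous (fun x => complex.Re (h x)).
Proof. by move=> ch x; apply: (cvg_comp _ _ (ch x)); exact: Re_continuous. Qed.

Lemma cIm_continuous (h : R -> C) :
  continuous h -> continuous (fun x => complex.Im (h x)).
Proof. by move=> ch x; apply: (cvg_comp _ _ (ch x)); exact: Im_continuous. Qed.

Lemma cintD (h k : R -> C) s : continuous h -> continuous k ->
  cint (fun x => h x + k x) s = cint h s + cint k s.
Proof.
move=> ch ck; rewrite /cint.
under eq_fun do rewrite ReD.
under [X in _ +i* rint X _]eq_fun do rewrite ImD.
by rewrite !rintD //; first [exact: cRe_continuous|exact: cIm_continuous].
Qed.

Lemma cint_split (h : R -> C) s t : 0 < s -> 0 < t -> continuous h ->
  cint h (s + t) = cint h s + cint (fun x => h (s + x)) t.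
Proof.
move=> s0 t0 ch; rewrite /cint.
rewrite (rint_split s0 t0 (cRe_continuous ch)).
by rewrite (rint_split s0 t0 (cIm_continuous ch)).
Qed.

Lemma cint_bound (h : R -> C) b s : 0 <= s -> continuous h ->
  (forall x, 0 <= x <= s -> nrm (h x) <= b) -> nrm (cint h s) <= 2 * b * s.
Proof.
move=> s0 ch hb; apply: (le_trans (nrm_le_ReIm _)).
rewrite -mulrA mulr2n mulrDl mul1r /=; apply: lerD.
  by apply: rint_bound (cRe_continuous ch) _ => // x /hb; apply: le_trans (Re_le_nrm _).
by apply: rint_bound (cIm_continuous ch) _ => // x /hb; apply: le_trans (Im_le_nrm _).
Qed.

(** The four sides of the square with lower left corner [c] and side [s] are
    parametrised by the same real variable, so that the integral along the
    boundary is one integral over [0, s] and contributions of common sides cancel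
    in the integrand. *)
Definition contour (h : C -> C) (c : C) (s x : R) : C :=
  let i : C := 'i in
  h (c + x%:C) + i * h (c + s%:C + i * x%:C)
  - h (c + i * s%:C + x%:C) - i * h (c + i * x%:C).

Definition square_integral (h : C -> C) (c : C) (s : R) : C :=
  cint (contour h c s) s.

Definition in_square (c : C) (s : R) (z : C) : Prop :=
  complex.Re c <= complex.Re z <= complex.Re c + s /\
  complex.Im c <= complex.Im z <= complex.Im c + s.

Lemma nrm_i : nrm ('i : C) = 1.
Proof. by rewrite /nrm normc_def /= expr0n expr1n add0r sqrtr1. Qed.

Lemma contour_bound (h : C -> C) c s x b :
  (forall z, in_square c s z -> nrm (h z) <= b) -> 0 <= x <= s ->
  nrm (contour h c s x) <= 4 * b.
Proof.
move=> hb /andP[x0 xs]; rewrite /contour.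
have s0 := le_trans x0 xs.
have -> : 4 * b = b + b + b + b by ring.
case: c hb => c1 c2 hb.
have H z : in_square (c1 +i* c2) s z -> nrm (h z) <= b by exact: hb.
apply: (le_trans (nrmB _ _)); apply: lerD; last first.
  rewrite nrmM nrm_i mul1r; apply: H; rewrite /in_square /=.
  by split; apply/andP; split; lra.
apply: (le_trans (nrmB _ _)); apply: lerD; last first.
  by apply: H; rewrite /in_square /=; split; apply/andP; split; lra.
apply: (le_trans (nrmD _ _)); apply: lerD.
- by apply: H; rewrite /in_square /=; split; apply/andP; split; lra.
- rewrite nrmM nrm_i mul1r; apply: H; rewrite /in_square /=.
  by split; apply/andP; split; lra.
Qed.

Lemma mul_continuous (T : topologicalType) (a : C) (k : T -> C) :
  continuous k -> continuous (fun x => a * k x).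
Proof. by move=> ck x; apply: cvgM; [exact: cvg_cst|exact: ck]. Qed.

Lemma add_continuous (T : topologicalType) (h k : T -> C) :
  continuous h -> continuous k -> continuous (fun x => h x + k x).
Proof. by move=> ch ck x; apply: cvgD; [exact: ch|exact: ck]. Qed.

Lemma contour_continuous (h : C -> C) c s :
  continuous h -> continuous (contour h c s).
Proof.
move=> ch; have H (a b : C) : continuous (fun x : R => h (a + b * x%:C)).
  move=> x; apply: (cvg_comp _ h _ (ch _)).
  apply: cvgD; first exact: cvg_cst.
  by apply: mul_continuous; exact: realC_continuous.
have H1 (a : C) : continuous (fun x : R => h (a + x%:C)).
  by have := H a 1; under eq_fun do rewrite mul1r.
move=> x; rewrite /contour; apply: cvgB; last by apply: mul_continuous; exact: H.
apply: cvgB; last exact: H1.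
by apply: cvgD; [exact: H1|apply: mul_continuous; exact: H].
Qed.

(** The interior sides are traversed twice in opposite directions. *)
Lemma square_integral_split (h : C -> C) c s : 0 < s -> continuous h ->
  square_integral h c (s + s) =
  square_integral h c s + square_integral h (c + s%:C) s +
  square_integral h (c + 'i * s%:C) s +
  square_integral h (c + s%:C + 'i * s%:C) s.
Proof.
move=> s0 ch; rewrite /square_integral.
have cc c' s' := @contour_continuous h c' s' ch.
rewrite cint_split // -!cintD //.
- congr (cint _ s); apply/funext => x; rewrite /contour !rmorphD /= !mulrDr !addrA.
  set i := ('i : C); set S := s%:C; set X := x%:C.
  have -> : c + S + i * S + X = c + i * S + S + X by ring.
  have -> : c + i * S + i * X = c + i * S + i * X by [].
  have -> : c + S + i * S + S + i * X = c + S + S + i * S + i * X by ring.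
  have -> : c + i * S + i * S + S + X = c + S + i * S + i * S + X by ring.
  have -> : c + i * S + S + i * X = c + S + i * S + i * X by ring.
  ring.
- by apply: add_continuous => //; exact: add_continuous.
- exact: add_continuous.
- move=> x; have := cc c (s + s) (s + x).
  apply: (@cvg_comp _ _ _ (fun y : R => s + y)).
  by apply: cvgD; [exact: cvg_cst|exact: cvg_id].
Qed.

End Goursat.

(** * Goursat's theorem on squares *)

Section GoursatThm.
Context {R : realType}.
Local Notation C := R[i].

(** The supremum of the left ends lies in every interval. *)
Lemma nested_intervals (a s : nat -> R) :
  (forall n, a n <= a n.+1) -> (forall n, a n.+1 + s n.+1 <= a n + s n) ->
  (forall n, 0 <= s n) -> exists x, forall n, a n <= x <= a n + s n.
Proof.
move=> ua us s0.
have ma : {homo a : m n / (m <= n)%N >-> m <= n}.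
  by apply: homo_leq => //; apply: le_trans.
have ms : {homo (fun n => a n + s n) : m n / (m <= n)%N >-> n <= m}.
  apply: (@homo_leq _ _ (fun x y => y <= x)) => //.
  by move=> x y z h k; apply: le_trans k h.
have H k n : a k <= a n + s n.
  rewrite (le_trans (ma _ _ (leq_maxl k n))) //.
  rewrite (le_trans _ (ms _ _ (leq_maxr k n))) //=.
  by rewrite lerDl.
exists (sup (range a)) => n; apply/andP; split.
  apply: (@ub_le_sup R (range a)); last by exists n.
  by exists (a 0%N + s 0%N) => _ [k _ <-].
by apply: ge_sup; [exists (a 0%N), 0%N|move=> _ [k _ <-]].
Qed.

(** The integrals over the four quarters add up to the integral over the square,
    and so do their areas. *)
Lemma square_integral_quarter (h : C -> C) c s (k : R) : 0 < s -> continuous h ->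
  k * (s + s) ^+ 2 <= nrm (square_integral h c (s + s)) ->
  exists2 c', in_square c s c' & k * s ^+ 2 <= nrm (square_integral h c' s).
Proof.
move=> s0 ch hk; apply: contrapT => hn.
have H c' : in_square c s c' -> nrm (square_integral h c' s) < k * s ^+ 2.
  by move=> hc; rewrite ltNge; apply/negP => hh; apply: hn; exists c'.
move: hk; apply/negP; rewrite -ltNge square_integral_split //.
have -> : k * (s + s) ^+ 2 = k * s ^+ 2 + k * s ^+ 2 + k * s ^+ 2 + k * s ^+ 2.
  by ring.
case: c H {hn} => c1 c2 H.
apply: (le_lt_trans (nrmD _ _)); apply: ltrD; last first.
  by apply: H; rewrite /in_square /=; split; apply/andP; split; lra.
apply: (le_lt_trans (nrmD _ _)); apply: ltrD; last first.
  by apply: H; rewrite /in_square /=; split; apply/andP; split; lra.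
apply: (le_lt_trans (nrmD _ _)); apply: ltrD; last first.
  by apply: H; rewrite /in_square /=; split; apply/andP; split; lra.
by apply: H; rewrite /in_square /=; split; apply/andP; split; lra.
Qed.

Lemma in_square_nrm (c : C) s z w : 0 <= s -> in_square c s z ->
  in_square c s w -> nrm (z - w) <= 2 * s.
Proof.
move=> s0 [/andP[a b] /andP[d e]] [/andP[a' b'] /andP[d' e']].
rewrite (le_trans (nrm_le_ReIm _)) // ReB ImB mulrDl mul1r.
by apply: lerD; rewrite ler_norml; apply/andP; split; lra.
Qed.

(** Goursat's argument sees the function inside the square only. *)
Definition cdiff_within (h : C -> C) (A : C -> Prop) (z0 : C) : Prop :=
  exists a : C, forall e : R, 0 < e -> exists2 d : R, 0 < d &
    forall z, A z -> nrm (z - z0) < d ->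
      nrm (h z - h z0 - a * (z - z0)) <= e * nrm (z - z0).

(** Affine functions have zero boundary integral already at the level of the
    integrand. *)
Lemma contour_affine (h : C -> C) (p a z0 : C) c s x :
  contour (fun z => h z - p - a * (z - z0)) c s x = contour h c s x.
Proof.
pose i : C := 'i; have ii : i * i = -1 by rewrite -expr2 sqr_i.
rewrite /contour; cbv beta zeta; rewrite -/i.
move: i s%:C x%:C ii => i S X ii.
move: (h (c + X)) (h (c + S + i * X)) (h (c + i * S + X)) (h (c + i * X)).
move=> h1 h2 h3 h4.
have -> : i * (h2 - p - a * (c + S + i * X - z0)) =
  i * h2 - i * p - i * a * (c + S - z0) - (i * i) * a * X by ring.
have -> : i * (h4 - p - a * (c + i * X - z0)) =
  i * h4 - i * p - i * a * (c - z0) - (i * i) * a * X by ring.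
rewrite ii; ring.
Qed.

(** The sides of repeatedly bisected squares; only the halving rule and the
    convergence to zero are used later, which keeps powers of 2 out of the way. *)
Lemma halving (s : R) : 0 < s -> exists S : nat -> R,
  [/\ S 0%N = s, forall n, 0 < S n, forall n, S n = S n.+1 + S n.+1
    & forall d, 0 < d -> exists n, S n < d].
Proof.
move=> s0; exists (fun n => s / 2 ^+ n); split.
- by rewrite expr0 divr1.
- by move=> n; rewrite divr_gt0 // exprn_gt0.
- by move=> n; rewrite exprS; field; rewrite expf_neq0.
move=> d d0; exists (Num.truncn (s / d)).+1.
have := truncnS_gt (s / d).
rewrite ltr_pdivrMr // => hn; rewrite ltr_pdivrMr ?exprn_gt0 //.
rewrite (lt_le_trans hn) // mulrC.
by rewrite ler_pM2l // -natrX ler_nat ltnW // ltn_expl.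
Qed.

(** A square with non-zero boundary integral contains a nested sequence of
    quarters whose integrals decrease no faster than their areas.  At the common
    point of these squares the function is affine up to an error small compared
    with the distance, so that the integrals decrease faster than the areas. *)
Lemma goursat (h : C -> C) c s : 0 < s -> continuous h ->
  (forall z0, in_square c s z0 -> cdiff_within h (in_square c s) z0) ->
  square_integral h c s = 0.
Proof.
move=> s0 ch dh; apply: contrapT => I0.
pose k := nrm (square_integral h c s) / s ^+ 2.
have k0 : 0 < k by rewrite divr_gt0 ?exprn_gt0 //; apply: nrm_gt0; apply/eqP.
have [S [Ss S0 SS Sd]] := halving s0.
have step (p : C * nat) : exists c', in_square p.1 (S p.2.+1) c' /\
    (k * S p.2 ^+ 2 <= nrm (square_integral h p.1 (S p.2)) ->
     k * S p.2.+1 ^+ 2 <= nrm (square_integral h c' (S p.2.+1))).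
  have [hk|hk] := pselect (k * S p.2 ^+ 2 <= nrm (square_integral h p.1 (S p.2))).
    move: (hk); rewrite {1 2}SS => /(square_integral_quarter (S0 _) ch) [c' h1 h2].
    by exists c'.
  exists p.1; split; last by move=> /hk.
  have hS := S0 p.2.+1; rewrite /in_square; clear -hS.
  by split; apply/andP; split; lra.
have [F hF] := choice step.
(* The lower left corners of the nested squares. *)
pose cs := fix cs n := if n is n'.+1 then F (cs n', n') else c.
have csS n : cs n.+1 = F (cs n, n) by [].
have big n : k * S n ^+ 2 <= nrm (square_integral h (cs n) (S n)).
  elim: n => [|n IH]; last by rewrite csS; apply: (hF (cs n, n)).2.
  by rewrite Ss /k divfK // expf_neq0 // gt_eqF.
have cin n : in_square (cs n) (S n.+1) (cs n.+1) by rewrite csS; apply: (hF (cs n, n)).1.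
have [x hx] : exists x, forall n, complex.Re (cs n) <= x <= complex.Re (cs n) + S n.
  apply: nested_intervals => n; last exact: ltW.
    by have [/andP[]] := cin n.
  by have [/andP[? ?] _] := cin n; rewrite [in leRHS]SS addrA lerD2r.
have [y hy] : exists x, forall n, complex.Im (cs n) <= x <= complex.Im (cs n) + S n.
  apply: nested_intervals => n; last exact: ltW.
    by have [_ /andP[]] := cin n.
  by have [_ /andP[? ?]] := cin n; rewrite [in leRHS]SS addrA lerD2r.
have sub n z : in_square (cs n) (S n) z -> in_square c s z.
  elim: n z => [|n IH] z; first by rewrite Ss.
  move=> [/andP[a b] /andP[d e]]; apply: IH.
  have [/andP[a' b'] /andP[d' e']] := cin n; rewrite /in_square.
  by have hS := SS n; clear -a b d e a' b' d' e' hS; split; apply/andP; split; lra.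
have zin n : in_square (cs n) (S n) (x +i* y) by split; [exact: hx|exact: hy].
have [a ha] := dh _ (sub 0%N _ (zin 0%N)).
(* A boundary integral is at most 16 times error times area, here half of [k]
   times the area. *)
have [d d0 hd] := ha (k / 32) (divr_gt0 k0 (ltr0n _ 32)).
have [n hn] : exists n, 2 * S n < d.
  have [n hn] := Sd (d / 2) (divr_gt0 d0 (ltr0n _ 2)).
  by exists n; rewrite mulrC -ltr_pdivlMr.
have := big n; apply/negP; rewrite -ltNge.
suff hS : nrm (square_integral h (cs n) (S n)) <= k / 2 * S n ^+ 2.
  by apply: (le_lt_trans hS); rewrite ltr_pM2r ?exprn_gt0 //; have := k0; lra.
have -> : k / 2 * S n ^+ 2 = 2 * (4 * (k / 32 * (2 * S n))) * S n by field.
apply: cint_bound; [exact: ltW|exact: contour_continuous|].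
move=> t ht; rewrite -(contour_affine h (h (x +i* y)) a (x +i* y)).
apply: contour_bound ht => z zn.
have zd := in_square_nrm (ltW (S0 n)) zn (zin n).
apply: (le_trans (hd z (sub _ _ zn) (le_lt_trans zd hn))).
by rewrite ler_pM2l // divr_gt0.
Qed.

End GoursatThm.

(** * Complex differentiability in one variable *)

Section ComplexDiff.
Context {R : realType}.
Local Notation C := R[i].

(** Caratheodory's form of differentiability: the difference quotient extends
    continuously.  The rules of differentiation become algebraic identities. *)
Definition cdiff (f : C -> C) (z : C) : Prop :=
  exists phi : C -> C, {for z, continuous phi} /\
    forall z', f z' = f z + (z' - z) * phi z'.

Lemma cdiff_near (f phi : C -> C) (z : C) : {for z, continuous phi} ->
  (\forall z' \near z, f z' = f z + (z' - z) * phi z') -> cdiff f z.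
Proof.
move=> cphi H; exists (fun z' => if z' == z then phi z else (f z' - f z) / (z' - z)).
split; last first.
  move=> z'; case: eqP => [->|/eqP nz]; first by rewrite subrr mul0r addr0.
  by rewrite mulrC divfK ?subr_eq0 // addrC subrK.
apply/continuous_nrmP => e e0; have /continuous_nrmP /(_ e e0) := cphi.
apply: filterS2 H => z' hz' hp; rewrite eqxx; case: eqP => [_|/eqP nz].
  by rewrite subrr nrm0.
suff -> : (f z' - f z) / (z' - z) = phi z' by [].
by rewrite hz' addrC addKr mulrC mulKf // subr_eq0.
Qed.

Lemma cdiff_continuous (f : C -> C) (z : C) : cdiff f z -> {for z, continuous f}.
Proof.
move=> [phi [cphi H]].
have -> : f = fun z' => f z + (z' - z) * phi z' by apply/funext.
apply: contD; first exact: cont_cst.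
apply: contM; last exact: cphi.
by apply: contB; [exact: cont_id|exact: cont_cst].
Qed.

Lemma cdiff_within_cdiff (f : C -> C) A (z : C) : cdiff f z -> cdiff_within f A z.
Proof.
move=> [phi [cphi H]]; exists (phi z) => e e0.
have /continuous_epsP /(_ e e0) [d d0 hd] := cphi.
exists d => // z' _ zd.
have -> : f z' - f z - phi z * (z' - z) = (phi z' - phi z) * (z' - z).
  by rewrite H; ring.
rewrite nrmM.
by rewrite ler_wpM2r ?nrm_ge0 // ltW // hd.
Qed.

Lemma cdiff_subC p z : cdiff (fun z => z - p) z.
Proof. by exists (fun=> 1); split=> [|z']; [exact: cont_cst|ring]. Qed.

Lemma cdiff_cst c z : cdiff (fun=> c) z.
Proof. by exists (fun=> 0); split=> [|z']; [exact: cont_cst|ring]. Qed.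

Lemma cdiffM (f g : C -> C) (z : C) : cdiff f z -> cdiff g z -> cdiff (fun z => f z * g z) z.
Proof.
move=> df dg; have cg := cdiff_continuous dg.
case: df dg => [phi [cphi H]] [psi [cpsi K]].
exists (fun z' => phi z' * g z' + f z * psi z'); split.
  by apply: contD; apply: contM;
    [exact: cphi|exact: cg|exact: cont_cst|exact: cpsi].
by move=> z'; rewrite (H z') (K z'); ring.
Qed.

Lemma cdiffX (f : C -> C) n (z : C) : cdiff f z -> cdiff (fun z => f z ^+ n) z.
Proof.
move=> df; elim: n => [|n IH]; first exact: cdiff_cst.
by under eq_fun do rewrite exprS; exact: cdiffM.
Qed.

Lemma cdiffB (f g : C -> C) (z : C) : cdiff f z -> cdiff g z -> cdiff (fun z => f z - g z) z.
Proof.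
move=> [phi [cphi H]] [psi [cpsi K]].
exists (fun z' => phi z' - psi z'); split; first by apply: contB; [exact: cphi|exact: cpsi].
by move=> z'; rewrite (H z') (K z'); ring.
Qed.

(** A zero of the second factor makes up for the lack of differentiability of
    the first. *)
Lemma cdiff_removable (f : C -> C) (p z : C) : {for z, continuous f} -> (z != p -> cdiff f z) ->
  cdiff (fun z => f z * (z - p)) z.
Proof.
move=> cf df; have [zp|/df zp] := eqVneq z p; last exact: cdiffM (cdiff_subC _ _).
exists f; split=> // z'; rewrite zp; ring.
Qed.

(** [phi] is the difference quotient of [f] with fixed point [a], and its
    denominator does not vanish near [z]. *)
Lemma cdiff_quotient (f phi : C -> C) (a z : C) : z != a ->
  (forall z', f z' = f a + (z' - a) * phi z') -> cdiff f z -> cdiff phi z.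
Proof.
move=> za H [psi [cpsi K]].
apply: (@cdiff_near _ (fun z' => (psi z' - phi z) / (z' - a))).
  apply: contM; first by apply: contB; [exact: cpsi|exact: cont_cst].
  apply: contV; first by rewrite subr_eq0.
  by apply: contB; [exact: cont_id|exact: cont_cst].
apply/nbhs_nrmP; exists (nrm (z - a)); first by apply: nrm_gt0; rewrite subr_eq0.
move=> z' hz'; have z'a : z' - a != 0.
  by apply: contraTneq hz' => /subr0_eq ->; rewrite nrmBC ltxx.
apply: (mulfI z'a); rewrite mulrDr mulrCA [_ * (_ / _)]mulrC divfK //.
have -> : (z' - a) * phi z' = f z' - f a by rewrite (H z'); ring.
rewrite (K z') (H z); ring.
Qed.

(** The supremum norm of R[i] as a real plane, whose balls are squares. *)
Definition cmax (z : C) : R := Num.max `|complex.Re z| `|complex.Im z|.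

Lemma cmax_le_nrm z : cmax z <= nrm z.
Proof. by rewrite /cmax ge_max Re_le_nrm Im_le_nrm. Qed.

Lemma cmaxP z r : cmax z <= r <-> `|complex.Re z| <= r /\ `|complex.Im z| <= r.
Proof. by rewrite /cmax ge_max; split=> /andP. Qed.

Lemma nrm_le_cmax z : nrm z <= 2 * cmax z.
Proof.
rewrite (le_trans (nrm_le_ReIm _)) // mulrDl mul1r.
by have [h1 h2] := (cmaxP z _).1 (lexx (cmax z)); apply: lerD.
Qed.

Lemma cmaxD z w : cmax (z + w) <= cmax z + cmax w.
Proof.
apply/cmaxP; rewrite ReD ImD.
have [h1 h2] := (cmaxP z _).1 (lexx _); have [k1 k2] := (cmaxP w _).1 (lexx _).
by split; apply: (le_trans (ler_normD _ _)); apply: lerD.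
Qed.

Lemma cmaxN z : cmax (- z) = cmax z.
Proof. by case: z => a b; rewrite /cmax /= !normrN. Qed.

Lemma cmax0 : cmax 0 = 0.
Proof. by rewrite /cmax /= normr0 maxxx. Qed.

End ComplexDiff.

(** * Squares with an exceptional centre *)

Section CenteredSquare.
Context {R : realType}.
Local Notation C := R[i].

Lemma square_integral_split_coord (h : C -> C) (x y s : R) : 0 < s -> continuous h ->
  square_integral h (x +i* y) (s + s) =
  square_integral h (x +i* y) s + square_integral h ((x + s) +i* y) s +
  square_integral h (x +i* (y + s)) s +
  square_integral h ((x + s) +i* (y + s)) s.
Proof.
move=> s0 ch; rewrite square_integral_split //.
have e1 : (x +i* y) + s%:C = (x + s) +i* y by apply/eqP; rewrite eq_complex /= addr0 !eqxx.
have e2 z : (z +i* y) + 'i * s%:C = z +i* (y + s).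
  apply/eqP; rewrite eq_complex /=; apply/andP; split; apply/eqP; ring.
by rewrite e1 !e2.
Qed.

Lemma in_centered_square (a1 a2 r : R) (z : C) :
  in_square ((a1 - r) +i* (a2 - r)) (r + r) z <-> cmax (z - (a1 +i* a2)) <= r.
Proof.
rewrite cmaxP ReB ImB /in_square /= !ler_norml.
split=> -[/andP[a b] /andP[c d]]; split; apply/andP; split; lra.
Qed.

(** A 4 x 4 grid: the twelve outer cells stay away from the centre and have zero
    integral, the four inner ones make up the square of half the size. *)
Lemma centered_square_halve (h : C -> C) (a1 a2 r r0 : R) : 0 < r -> r + r <= r0 ->
  continuous h ->
  (forall z, cmax (z - (a1 +i* a2)) <= r0 -> z != a1 +i* a2 ->
    cdiff_within h (fun z => cmax (z - (a1 +i* a2)) <= r0) z) ->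
  square_integral h ((a1 - (r + r)) +i* (a2 - (r + r))) (r + r + (r + r)) =
  square_integral h ((a1 - r) +i* (a2 - r)) (r + r).
Proof.
move=> rpos rr ch dh.
have Z (j k : R) : - (r + r) <= j <= r -> - (r + r) <= k <= r ->
    (0 < j) || (j + r < 0) || (0 < k) || (k + r < 0) ->
    square_integral h ((a1 + j) +i* (a2 + k)) r = 0.
  move=> /andP[j1 j2] /andP[k1 k2] jk; apply: goursat => // z0 hz0.
  have sub z : in_square ((a1 + j) +i* (a2 + k)) r z -> cmax (z - (a1 +i* a2)) <= r0.
    rewrite cmaxP ReB ImB /in_square /= !ler_norml => -[/andP[a b] /andP[c d]].
    clear jk; split; apply/andP; split; lra.
  have [||l hl] := dh z0.
  - exact: sub.
  - apply: contraTneq jk => e; move: hz0; rewrite e /in_square /= => -[/andP[a b] /andP[c d]].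
    by rewrite !negb_or -!leNgt -!andbA; do ![apply/andP; split]; lra.
  exists l => e e0; have [d d0 hd] := hl e e0.
  by exists d => // z hz; apply: hd; apply: sub.
pose J j k s := square_integral h ((a1 + j) +i* (a2 + k)) s.
have S j k s : 0 < s -> J j k (s + s) =
    J j k s + J (j + s) k s + J j (k + s) s + J (j + s) (k + s) s.
  by move=> s0; rewrite /J square_integral_split_coord // !addrA.
rewrite -[LHS]/(J (- (r + r)) (- (r + r)) (r + r + (r + r))).
rewrite -[RHS]/(J (- r) (- r) (r + r)).
have E : - (r + r) + r = - r by ring.
rewrite (S _ _ (r + r)) ?addr_gt0 // !S // !addNr !add0r !E.
have Z' j k : - (r + r) <= j <= r -> - (r + r) <= k <= r ->
  (0 < j) || (j + r < 0) || (0 < k) || (k + r < 0) -> J j k r = 0 by exact: Z.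
have b0 : - (r + r) <= 0 <= r by apply/andP; split; lra.
have b1 : - (r + r) <= - (r + r) <= r by apply/andP; split; lra.
have b2 : - (r + r) <= - r <= r by apply/andP; split; lra.
have b3 : - (r + r) <= r <= r by apply/andP; split; lra.
have c1 : - (r + r) + r < 0 by lra.
rewrite !(Z' _ r) ?rpos ?orbT // !(Z' r) ?rpos ?orbT //.
rewrite !(Z' _ (- (r + r))) ?c1 ?orbT // !(Z' (- (r + r))) ?c1 ?orbT //.
by rewrite !(addr0, add0r).
Qed.

Lemma continuous_cmax (h : C -> C) a : continuous h -> exists2 B, 0 <= B &
  exists2 d : R, 0 < d & forall z, cmax (z - a) < d -> nrm (h z) <= B.
Proof.
move=> ch; have /continuous_epsP /(_ 1 ltr01) [d d0 hd] := ch a.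
exists (nrm (h a) + 1); first by rewrite addr_ge0 ?nrm_ge0.
exists (d / 2) => [|z hz]; first by rewrite divr_gt0.
have : nrm (h z - h a) < 1.
  by apply: hd; apply: (le_lt_trans (nrm_le_cmax _)); rewrite mulrC -ltr_pdivlMr.
move=> /ltW h1; rewrite -[h z](subrK (h a)) (le_trans (nrmD _ _)) // addrC lerD2l //.
Qed.

(** The integral does not change when the square shrinks to its centre, while it
    is bounded by a constant times the side. *)
Lemma goursat_punctured (h : C -> C) (a1 a2 r : R) : 0 < r -> continuous h ->
  (forall z, cmax (z - (a1 +i* a2)) <= r -> z != a1 +i* a2 ->
    cdiff_within h (fun z => cmax (z - (a1 +i* a2)) <= r) z) ->
  square_integral h ((a1 - r) +i* (a2 - r)) (r + r) = 0.
Proof.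
move=> r0 ch dh; have [S [Sr S0 SS Sd]] := halving r0.
have Sle n : S n <= r.
  elim: n => [|n IH]; first by rewrite Sr.
  by have := SS n; have := S0 n.+1; lra.
pose I r := square_integral h ((a1 - r) +i* (a2 - r)) (r + r).
have IS n : I (S n) = I r.
  elim: n => [|n IH]; first by rewrite Sr.
  rewrite -IH (SS n) /I (centered_square_halve (S0 n.+1) _ ch dh) //.
  by rewrite -SS.
rewrite -/(I r); apply: nrm_eq0; apply/eqP; rewrite eq_le nrm_ge0 andbT.
have [B B0 [d d0 hd]] := continuous_cmax (a1 +i* a2) ch.
apply/ler_addgt0Pl => e e0; rewrite addr0.
pose m := Num.min d (e / (16 * (B + 1))).
have B1 : 0 < 16 * (B + 1) by lra.
have m0 : 0 < m by rewrite lt_min d0 divr_gt0.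
have [n] := Sd m m0; rewrite lt_min => /andP[n1 n2].
rewrite -(IS n).
have -> : e = e / (16 * (B + 1)) * (16 * (B + 1)) by rewrite divfK // gt_eqF.
rewrite ltr_pdivlMr // in n2; rewrite divfK ?gt_eqF //.
apply: (@le_trans _ _ (2 * (4 * B) * (S n + S n))).
  apply: cint_bound; first by rewrite ltW // addr_gt0.
    exact: contour_continuous.
  move=> x hx; apply: contour_bound hx => z /in_centered_square hz.
  by apply: hd; apply: le_lt_trans n1.
have -> : 2 * (4 * B) * (S n + S n) = S n * (16 * B) by ring.
apply: (le_trans _ (ltW n2)); rewrite ler_pM2l //; lra.
Qed.

End CenteredSquare.

(** * A maximum principle with a constant *)

Section MaxPrinciple.
Context {R : realType}.
Local Notation C := R[i].

Definition clamp (r t : R) : R := Num.max (- r) (Num.min t r).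

(** The nearest point of a centred square.  Composition with this map turns a
    function that is continuous on the square into one that is continuous on the
    plane and has the same boundary integral. *)
Definition cclamp (a : C) (r : R) (z : C) : C :=
  a + (clamp r (complex.Re (z - a)) +i* clamp r (complex.Im (z - a))).

Lemma clamp_bound r t : 0 <= r -> `|clamp r t| <= r.
Proof.
move=> r0; rewrite /clamp ler_norml le_max lexx /= ge_max ge_min lexx orbT andbT.
by rewrite ge0_cp.
Qed.

Lemma clamp_id r t : `|t| <= r -> clamp r t = t.
Proof.
by rewrite /clamp ler_norml => /andP[h1 h2]; rewrite (min_idPl h2) (max_idPr h1).
Qed.

Lemma clamp_lip r t u : `|clamp r t - clamp r u| <= `|t - u|.
Proof.
have maxl (a x y : R) : `|Num.max a x - Num.max a y| <= `|x - y|.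
  have h1 := ler_norm (x - y); have h2 := ler_norm (- (x - y)).
  rewrite normrN in h2; rewrite ler_norml.
  by case: (leP a x) => h3; case: (leP a y) => h4; apply/andP; split; lra.
apply: (le_trans (maxl _ _ _)).
have h1 := ler_norm (t - u); have h2 := ler_norm (- (t - u)).
rewrite normrN in h2; rewrite ler_norml.
by case: (leP t r) => h3; case: (leP u r) => h4; apply/andP; split; lra.
Qed.

Lemma cclamp_bound a r z : 0 <= r -> cmax (cclamp a r z - a) <= r.
Proof.
move=> r0; rewrite /cclamp addrC addKr; apply/cmaxP.
by split; exact: clamp_bound.
Qed.

Lemma cclamp_id a r z : cmax (z - a) <= r -> cclamp a r z = z.
Proof.
move=> /cmaxP [h1 h2]; rewrite /cclamp !clamp_id //.
have E (w : C) : (complex.Re w +i* complex.Im w) = w by case: w.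
by rewrite E addrC subrK.
Qed.

Lemma cclamp_continuous a r : continuous (cclamp a r).
Proof.
move=> z; apply/continuous_epsP => e e0; exists (e / 2); first by rewrite divr_gt0.
move=> w hw; rewrite (le_lt_trans (nrm_le_cmax _)) // mulrC -ltr_pdivlMr //.
apply: le_lt_trans hw; rewrite (le_trans _ (cmax_le_nrm _)) //.
have [h1 h2] := (cmaxP (w - z) _).1 (lexx _).
apply/cmaxP; split.
  apply: (le_trans _ h1).
  have -> : complex.Re (cclamp a r w - cclamp a r z) =
    clamp r (complex.Re (w - a)) - clamp r (complex.Re (z - a)).
    by rewrite /cclamp ReB !ReD /= opprD addrACA subrr add0r.
  by rewrite (le_trans (clamp_lip _ _ _)) // !ReB opprB addrA subrK.
apply: (le_trans _ h2).
have -> : complex.Im (cclamp a r w - cclamp a r z) =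
  clamp r (complex.Im (w - a)) - clamp r (complex.Im (z - a)).
  by rewrite /cclamp ImB !ImD /= opprD addrACA subrr add0r.
by rewrite (le_trans (clamp_lip _ _ _)) // !ImB opprB addrA subrK.
Qed.

(** Cauchy's integral formula: the difference quotient of [f] at the centre has
    zero boundary integral, and the boundary integral of 1/(z - a) is the
    integral of 4 i r / (u^2 + r^2) over |u| <= r, of modulus at least 4. *)
Lemma weak_max_principle (f : C -> C) (a1 a2 r M : R) : 0 < r ->
  (forall z, cmax (z - (a1 +i* a2)) <= r -> cdiff f z) ->
  (forall z, cmax (z - (a1 +i* a2)) = r -> nrm (f z) <= M) ->
  nrm (f (a1 +i* a2)) <= 4 * M.
Proof.
move=> r0 df fM; set a := a1 +i* a2.
have aa : cmax (a - a) <= r by rewrite subrr cmax0 ltW.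
have [phi [cphi Hphi]] := df a aa.
(* The difference quotient of [f] at [a], made continuous on the whole plane. *)
pose h z := phi (cclamp a r z).
have dphi z : cmax (z - a) <= r -> z != a -> cdiff phi z.
  by move=> hz za; apply: cdiff_quotient za Hphi _; apply: df.
have ch : continuous h.
  move=> z; apply: continuous_comp; first exact: cclamp_continuous.
  have [->|za] := eqVneq (cclamp a r z) a; first exact: cphi.
  by apply: cdiff_continuous; apply: dphi => //; apply: cclamp_bound; rewrite ltW.
have hE z : cmax (z - a) <= r -> (z - a) * h z = f z - f a.
  by move=> hz; rewrite /h cclamp_id // (Hphi z); ring.
have I0 : square_integral h ((a1 - r) +i* (a2 - r)) (r + r) = 0.
  apply: goursat_punctured => // z hz za.
  have [l hl] := cdiff_within_cdiff (fun z => cmax (z - a) <= r) (dphi z hz za).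
  exists l => e e0; have [d d0 hd] := hl e e0; exists d => // w hw wd.
  by rewrite /h !cclamp_id //; apply: hd.
set c := (a1 - r) +i* (a2 - r) in I0.
pose k (x : R) : R := 4 * r / ((x - r) ^+ 2 + r ^+ 2).
have kd x : 0 < (x - r) ^+ 2 + r ^+ 2.
  by rewrite ltr_wpDl ?sqr_ge0 ?exprn_gt0.
have ck : continuous k.
  move=> x; apply: cvgM; first exact: cvg_cst.
  apply: cvgV; first by rewrite gt_eqF.
  apply: cvgD; last exact: cvg_cst.
  have cu : {for x, continuous (fun y : R => y - r)}.
    by apply: cvgB; [exact: cvg_id|exact: cvg_cst].
  have -> : (fun y : R => (y - r) ^+ 2) = fun y => (y - r) * (y - r).
    by apply/funext => y; rewrite expr2.
  by rewrite expr2; apply: cvgM; exact: cu.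
have kbig : 4 <= rint k (r + r).
  have <- : rint (fun=> 4 * r / (r ^+ 2 + r ^+ 2)) (r + r) = 4.
    rewrite rint_cst ?addr_ge0 ?ltW //; field.
    by rewrite gt_eqF // addr_gt0 // exprn_gt0.
  apply: le_rint => //.
    by move=> x; exact: cvg_cst.
  move=> x /andP[x0 x1]; rewrite ler_pM2l ?mulr_gt0 // lef_pV2 ?posrE ?kd ?addr_gt0 ?exprn_gt0 //.
  rewrite lerD2r -[leLHS]ger0_norm ?sqr_ge0 // normrX.
  suff hx : `|x - r| ^+ 2 <= r ^+ 2 by [].
  by rewrite ler_sqr ?nnegrE ?normr_ge0 ?(ltW r0) // ler_norml; apply/andP; split; lra.
pose i : C := 'i; have ii : i * i = -1 by rewrite -expr2 sqr_i.
have ik (x : R) (A B : C) : A = (x - r)%:C - i * r%:C -> B = (x - r)%:C + i * r%:C ->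
    [/\ A != 0, B != 0 & A^-1 + A^-1 - B^-1 - B^-1 = i * (k x)%:C].
  move=> eA eB; have AB : A * B = ((x - r) ^+ 2 + r ^+ 2)%:C.
    have -> : ((x - r) ^+ 2 + r ^+ 2)%:C = (x - r)%:C ^+ 2 + r%:C ^+ 2.
      by rewrite -!rmorphXn -rmorphD.
    rewrite eA eB.
    move: (x - r)%:C r%:C => X Y.
    have -> : (X - i * Y) * (X + i * Y) = X ^+ 2 - (i * i) * Y ^+ 2 by ring.
    by rewrite ii; ring.
  have AB0 : A * B != 0.
    by rewrite AB -(rmorph0 (real_complex R)) (inj_eq (@complexI R)) gt_eqF.
  have [A0 B0] : A != 0 /\ B != 0 by move: AB0; rewrite mulf_eq0 negb_or => /andP.
  split=> //.
  have -> : (k x)%:C = 4 * r%:C / (A * B).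
    by rewrite AB /k fmorph_div rmorphM rmorph_nat.
  have -> : A^-1 + A^-1 - B^-1 - B^-1 = (2 * (B - A)) / (A * B) by field; rewrite A0 B0.
  by rewrite mulrA; congr (_ / _); rewrite eA eB; ring.
(* On the boundary, [G] is the contour integrand of f(z) / (z - a). *)
pose G x := contour h c (r + r) x + f a * i * (k x)%:C.
have cG : continuous (contour h c (r + r)) by exact: contour_continuous.
have ci : continuous (fun x : R => f a * i * (k x)%:C : C).
  move=> x.
  refine (@contM R _ x (fun=> f a * i) (fun y => (k y)%:C) _ _).
    exact: cont_cst.
  exact: (@continuous_comp _ _ _ k (fun t => t%:C) x (ck x) (@realC_continuous R (k x))).
have intk : cint (fun x => f a * i * (k x)%:C) (r + r) = f a * i * (rint k (r + r))%:C.
  rewrite /cint; case: (f a * i) => p q.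
  have -> : (fun x => complex.Re ((p +i* q) * (k x)%:C)) = fun x => p * k x.
    by apply/funext => x /=; ring.
  have -> : (fun x => complex.Im ((p +i* q) * (k x)%:C)) = fun x => q * k x.
    by apply/funext => x /=; ring.
  by rewrite (rintZ p _ ck) (rintZ q _ ck); apply/eqP; rewrite eq_complex /= !mulr0 subr0 add0r !eqxx.
have GE : cint G (r + r) = f a * i * (rint k (r + r))%:C.
  by rewrite /G cintD // intk; move: I0; rewrite /square_integral => ->; rewrite add0r.
have M0 : 0 <= M.
  apply: (le_trans _ (fM (a + r%:C) _)); first exact: nrm_ge0.
  by rewrite addrC addKr /cmax /= normr0 gtr0_norm // max_l // ltW.
have Gb : nrm (cint G (r + r)) <= 2 * (4 * (M / r)) * (r + r).
  apply: cint_bound; first by rewrite addr_ge0 // ltW.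
    by move=> x; exact: (@contD R _ x _ _ (cG x) (ci x)).
  move=> x /andP[x0 x1].
  have [A0 B0 ABk] := ik x _ _ (erefl _) (erefl _).
  set A := _ - _ in A0 ABk; set B := _ + _ in B0 ABk.
  have xr : `|x - r| <= r by rewrite ler_norml; apply/andP; split; lra.
  have Ec (p q p' q' : R) : p = p' -> q = q' -> (p +i* q) = (p' +i* q') :> C by move=> -> ->.
  have e1 : c + x%:C - a = A.
    by rewrite /A /i /c /a; apply: Ec; ring.
  have e2 : c + (r + r)%:C + i * x%:C - a = i * A.
    by rewrite /A /i /c /a; apply: Ec; ring.
  have e3 : c + i * (r + r)%:C + x%:C - a = B.
    by rewrite /B /i /c /a; apply: Ec; ring.
  have e4 : c + i * x%:C - a = i * B.
    by rewrite /B /i /c /a; apply: Ec; ring.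
  have cA : cmax A = r.
    by rewrite /A /i /cmax /= !(mul0r, mul1r, mulr0, add0r, addr0, subr0, oppr0, sub0r, normrN) (gtr0_norm r0) max_r.
  have cB : cmax B = r.
    by rewrite /B /i /cmax /= !(mul0r, mul1r, mulr0, add0r, addr0, subr0, oppr0, sub0r, normrN) (gtr0_norm r0) max_r.
  have ci' w : cmax (i * w) = cmax w.
    by case: w => p q; rewrite /i /cmax /= !(mul0r, mul1r, add0r, sub0r, normrN) maxC.
  have bd z w : z - a = w -> cmax w = r -> nrm (f z) <= M /\ w * h z = f z - f a.
    by move=> e cw; split; [apply: fM; rewrite e|rewrite -e hE // e cw].
  rewrite /G /contour; cbv zeta; rewrite -/i.
  move: e1 e2 e3 e4; set z1 := c + x%:C; set z2 := c + _ + _ ; set z3 := c + i * _ + _; set z4 := c + i * _.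
  move=> /bd /(_ cA) [b1 h1] /bd /(_ (etrans (ci' _) cA)) [b2 h2].
  move=> /bd /(_ cB) [b3 h3] /bd /(_ (etrans (ci' _) cB)) [b4 h4].
  have -> : h z1 + i * h z2 - h z3 - i * h z4 + f a * i * (k x)%:C =
      f z1 * A^-1 + f z2 * A^-1 - f z3 * B^-1 - f z4 * B^-1.
    rewrite -mulrA -ABk.
    have -> : f z1 = A * h z1 + f a by rewrite h1 subrK.
    have -> : f z2 = i * A * h z2 + f a by rewrite h2 subrK.
    have -> : f z3 = B * h z3 + f a by rewrite h3 subrK.
    have -> : f z4 = i * B * h z4 + f a by rewrite h4 subrK.
    by field; rewrite A0 B0.
  have nA : nrm A^-1 <= r^-1.
    by rewrite nrmV lef_pV2 ?posrE ?nrm_gt0 // -{1}cA cmax_le_nrm.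
  have nB : nrm B^-1 <= r^-1.
    by rewrite nrmV lef_pV2 ?posrE ?nrm_gt0 // -{1}cB cmax_le_nrm.
  have -> : 4 * (M / r) = M / r + M / r + M / r + M / r by ring.
  apply: (le_trans (nrmB _ _)); apply: lerD; last by rewrite nrmM ler_pM ?nrm_ge0.
  apply: (le_trans (nrmB _ _)); apply: lerD; last by rewrite nrmM ler_pM ?nrm_ge0.
  by apply: (le_trans (nrmD _ _)); apply: lerD; rewrite nrmM ler_pM ?nrm_ge0.
rewrite -(ler_pM2r (_ : 0 < 4)) //.
apply: (@le_trans _ _ (nrm (cint G (r + r)))).
  rewrite GE !nrmM nrm_i mulr1 nrmR ler_wpM2l ?nrm_ge0 // ger0_norm //.
  by apply: le_trans kbig.
apply: (le_trans Gb); rewrite le_eqVlt; apply/orP; left; apply/eqP.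
by field; rewrite gt_eqF.
Qed.
End MaxPrinciple.

(** * The maximum principle and Cauchy estimates *)

Section Estimates.
Context {R : realType}.
Local Notation C := R[i].

(** Comparing n-th powers as n grows removes constant factors. *)
Lemma power_domination (x y k L : R) : 0 <= y -> 0 < k ->
  (forall n, x ^+ n * k <= y ^+ n * L) -> x <= y.
Proof.
move=> y0 k0 H; rewrite leNgt; apply/negP => yx.
have x0 : 0 < x := le_lt_trans y0 yx.
have q1 : `|y / x| < 1.
  by rewrite ger0_norm ?divr_ge0 ?(ltW x0) // ltr_pdivrMr // mul1r.
have L0 : 0 < `|L| + 1 by rewrite ltr_wpDl.
have /cvgrPdist_lt /(_ (k / (`|L| + 1))) := cvg_expr q1.
rewrite divr_gt0 // => /(_ isT) [n _ /(_ n (leqnn n))].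
rewrite /= sub0r normrN => hn.
have := H n; apply/negP; rewrite -ltNge.
have qn : `|(y / x) ^+ n| = y ^+ n / x ^+ n.
  by rewrite ger0_norm ?exprn_ge0 ?divr_ge0 ?(ltW x0) // expr_div_n.
rewrite qn ltr_pdivrMr ?exprn_gt0 // mulrAC ltr_pdivlMr // in hn.
rewrite [ltRHS]mulrC; apply: (le_lt_trans _ hn); apply: ler_wpM2l; first exact: exprn_ge0.
by rewrite (le_trans (ler_norm L)) // lerDl.
Qed.

Lemma contX (T : topologicalType) (f : T -> C) x n :
  {for x, continuous f} -> {for x, continuous (fun y => f y ^+ n)}.
Proof.
move=> cf; elim: n => [|n IH]; first exact: cont_cst.
have -> : (fun y => f y ^+ n.+1) = fun y => f y * f y ^+ n.
  by apply/funext => y; rewrite exprS.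
exact: (contM cf IH).
Qed.

Lemma cmaxB_le (z w u : C) : cmax (z - u) <= cmax (z - w) + cmax (w - u).
Proof. by rewrite (le_trans _ (cmaxD _ _)) // addrA subrK. Qed.

(** The product of f^n with (z - p1) (z - p2) is differentiable at the exceptional
    points as well, and the constants in its weak maximum principle do not matter
    for large n. *)
Lemma max_principle (f : C -> C) (a p1 p2 : C) (r M : R) : 0 < r ->
  a != p1 -> a != p2 ->
  (forall z, cmax (z - a) <= r -> {for z, continuous f}) ->
  (forall z, cmax (z - a) <= r -> z != p1 -> z != p2 -> cdiff f z) ->
  (forall z, cmax (z - a) = r -> nrm (f z) <= M) ->
  nrm (f a) <= M.
Proof.
case: a => a1 a2; set a := a1 +i* a2 => r0 ap1 ap2 cf df fM.
have M0 : 0 <= M.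
  apply: (le_trans _ (fM (a + r%:C) _)); first exact: nrm_ge0.
  by rewrite addrC addKr /cmax /= normr0 gtr0_norm // max_l // ltW.
have k0 : 0 < nrm (a - p1) * nrm (a - p2) by rewrite mulr_gt0 // nrm_gt0 // subr_eq0.
pose K p := 2 * (r + cmax (a - p)).
have Kb z p : cmax (z - a) = r -> nrm (z - p) <= K p.
  move=> hz; rewrite (le_trans (nrm_le_cmax _)) // ler_pM2l //.
  by rewrite (le_trans (cmaxB_le _ a _)) // hz.
apply: (power_domination M0 k0 (L := 4 * (K p1 * K p2))) => n.
pose F z := f z ^+ n * (z - p1) * (z - p2).
have -> : nrm (f a) ^+ n * (nrm (a - p1) * nrm (a - p2)) = nrm (F a).
  rewrite /F !nrmM mulrA; congr (_ * _ * _).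
  by elim: n {F} => [|n IH]; rewrite ?expr0 ?exprS ?nrmM ?IH // /nrm normr1.
have -> : M ^+ n * (4 * (K p1 * K p2)) = 4 * (M ^+ n * K p1 * K p2) by ring.
apply: weak_max_principle r0 _ _ => z hz.
  have cn : {for z, continuous (fun y => f y ^+ n)} := contX (cf z hz).
  apply: cdiff_removable => [|zp2].
    exact: (contM cn (contB (@cont_id _ z) (@cont_cst _ _ z p1))).
  apply: cdiff_removable => [|zp1]; first exact: cn.
  by apply: cdiffX; apply: df.
rewrite /F !nrmM.
have fn : nrm (f z ^+ n) <= M ^+ n.
  elim: n {F} => [|n IH]; first by rewrite !expr0 /nrm normr1.
  by rewrite !exprS nrmM ler_pM ?nrm_ge0 // fM.
by rewrite !ler_pM ?mulr_ge0 ?nrm_ge0 ?Kb.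
Qed.

Lemma cont_quotient (f phi : C -> C) (a z : C) : z != a ->
  (forall z', f z' = f a + (z' - a) * phi z') -> {for z, continuous f} ->
  {for z, continuous phi}.
Proof.
move=> za H cf.
have cq : {for z, continuous (fun z' => (f z' - f a) * (z' - a)^-1)}.
  apply: contM; first by apply: contB; [exact: cf|exact: cont_cst].
  apply: contV; first by rewrite subr_eq0.
  by apply: contB; [exact: cont_id|exact: cont_cst].
have E z' : z' != a -> (f z' - f a) * (z' - a)^-1 = phi z'.
  by move=> z'a; rewrite (H z') [f a + _]addrC addrK mulrC mulKf // subr_eq0.
apply/continuous_epsP => e e0; move/continuous_epsP: cq => /(_ e e0) [d d0 hd].
exists (Num.min d (nrm (z - a))); first by rewrite lt_min d0 nrm_gt0 // subr_eq0.
move=> w; rewrite lt_min => /andP[/hd h1 h2].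
rewrite -(E z) // -(E w) //.
by apply: contraTneq h2 => ->; rewrite nrmBC ltxx.
Qed.

(** The difference quotient of [g] with fixed point [t] is bounded on the
    boundary of a square centred at [s] that leaves [t] well inside; the maximum
    principle carries the bound to [s]. *)
Lemma cauchy_lipschitz (g : C -> C) (p : C) (r M : R) : 0 < r ->
  (forall z, cmax z <= r -> {for z, continuous g}) ->
  (forall z, cmax z <= r -> z != p -> cdiff g z) ->
  (forall z, cmax z <= r -> nrm (g z) <= M) ->
  forall s t, s != p -> t != p -> cmax s <= r / 8 -> cmax t <= r / 8 ->
  nrm (g s - g t) <= 8 * M / r * nrm (s - t).
Proof.
move=> r0 cg dg gM s t sp tp hs ht.
have [->|st] := eqVneq s t; first by rewrite !subrr !nrm0 mulr0.
have tr : cmax t <= r by lra.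
have [q [cq Hq]] := dg t tr tp.
have -> : g s - g t = (s - t) * q s by rewrite (Hq s); ring.
rewrite nrmM mulrC; apply: ler_wpM2r; first exact: nrm_ge0.
have r2 : 0 < r / 2 by rewrite divr_gt0.
have sub z : cmax (z - s) <= r / 2 -> cmax z <= r.
  by move=> hz; have := cmaxB_le z s 0; rewrite !subr0; lra.
apply: (max_principle r2 st sp) => z hz.
- have [->|zt] := eqVneq z t; first exact: cq.
  by apply: cont_quotient zt Hq _; apply/cg/sub.
- by move=> zt zp; apply: cdiff_quotient zt Hq _; apply: dg => //; apply: sub.
have zr : cmax z <= r by apply: sub; rewrite hz.
have zt : r / 4 <= cmax (z - t).
  have h1 := cmaxB_le z t s; have h2 := cmaxB_le t 0 s.
  by rewrite subr0 sub0r cmaxN in h2; lra.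
have zt0 : 0 < nrm (z - t) by apply: lt_le_trans (cmax_le_nrm _); lra.
rewrite -(ler_pM2l zt0) -nrmM.
have -> : (z - t) * q z = g z - g t by rewrite (Hq z); ring.
rewrite (le_trans (nrmB _ _)) //.
have M0 : 0 <= M by apply: le_trans (gM z zr); exact: nrm_ge0.
apply: (@le_trans _ _ (M + M)); first by apply: lerD; apply: gM.
have -> : M + M = r / 4 * (8 * M / r) by field; rewrite gt_eqF.
apply: ler_wpM2r; last by apply: (le_trans zt); exact: cmax_le_nrm.
by rewrite divr_ge0 ?mulr_ge0 // ltW.
Qed.

(** The Cauchy estimate for the difference quotient of [g] at 0, with 0 as its
    exceptional point. *)
Lemma cauchy_divided_lipschitz (g : C -> C) (r M : R) : 0 < r ->
  (forall z, cmax z <= r -> cdiff g z) ->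
  (forall z, cmax z <= r -> nrm (g z) <= M) ->
  forall s t, s != 0 -> t != 0 -> cmax s <= r / 8 -> cmax t <= r / 8 ->
  nrm ((g s - g 0) / s - (g t - g 0) / t) <= 128 * M / r ^+ 2 * nrm (s - t).
Proof.
move=> r0 dg gM s t s0 t0 hs ht.
have c0 : cmax (0 : C) <= r by rewrite cmax0 ltW.
have M0 : 0 <= M by apply: le_trans (gM 0 c0); exact: nrm_ge0.
have [q [cq Hq]] := dg 0 c0.
have qE z : z != 0 -> (g z - g 0) / z = q z.
  by move=> z0; rewrite (Hq z) subr0 [g 0 + _]addrC addrK mulrC mulKf.
rewrite !qE //.
have -> : 128 * M / r ^+ 2 = 8 * (16 * M / r) / r by field; rewrite gt_eqF.
apply: (@cauchy_lipschitz q 0 r (16 * M / r) r0 _ _ _ s t s0 t0 hs ht) => z hz.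
- have [->|z0] := eqVneq z 0; first exact: cq.
  by apply: cont_quotient z0 Hq _; apply/cdiff_continuous/dg.
- by move=> z0; apply: cdiff_quotient z0 Hq _; apply: dg.
have far w : r / 8 <= cmax w -> cmax w <= r -> nrm (q w) <= 16 * M / r.
  move=> h1 h2; have w0 : w != 0.
    by apply: contraTneq h1 => ->; rewrite cmax0 -ltNge; lra.
  have nw : 0 < nrm w by exact: nrm_gt0.
  rewrite -(ler_pM2l nw) -nrmM.
  have -> : w * q w = g w - g 0 by rewrite (Hq w); ring.
  rewrite (le_trans (nrmB _ _)) //.
  apply: (@le_trans _ _ (M + M)); first by apply: lerD; apply: gM.
  have -> : M + M = r / 8 * (16 * M / r) by field; rewrite gt_eqF.
  apply: ler_wpM2r; last by apply: (le_trans h1); exact: cmax_le_nrm.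
  by rewrite divr_ge0 ?mulr_ge0 // ltW.
have near0 w : w != 0 -> cmax w <= r / 8 -> nrm (q w) <= 16 * M / r.
  move=> w0 hw; have nw : 0 < nrm w by exact: nrm_gt0.
  rewrite -(ler_pM2l nw) -nrmM.
  have -> : w * q w = g w - g 0 by rewrite (Hq w); ring.
  have hp (u : C) : cmax u <= r / 8 -> u != r%:C.
    move=> hu; apply: contraTneq hu => ->.
    by rewrite -ltNge /cmax /= normr0 gtr0_norm // max_l ?(ltW r0) //; lra.
  have h0 : cmax (0 : C) <= r / 8 by rewrite cmax0; lra.
  have hcl := cauchy_lipschitz r0 (fun z hz => cdiff_continuous (dg z hz))
    (fun z hz _ => dg z hz) gM (hp _ hw) (hp _ h0) hw h0.
  rewrite subr0 in hcl; apply: (le_trans hcl).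
  rewrite mulrC ler_wpM2l ?nrm_ge0 // ler_wpM2r ?invr_ge0 ?(ltW r0) //.
  by rewrite ler_wpM2r // ler_nat.
have allbut w : w != 0 -> cmax w <= r -> nrm (q w) <= 16 * M / r.
  move=> w0 hw; have [h|/ltW h] := leP (cmax w) (r / 8); first exact: near0.
  exact: far.
have [->|z0] := eqVneq z 0; last exact: allbut.
rewrite leNgt; apply/negP => hq; move/continuous_epsP: cq.
move=> /(_ (nrm (q 0) - 16 * M / r)); rewrite subr_gt0 => /(_ hq) [d d0 hd].
(* At the exceptional point the bound follows by continuity. *)
pose u := Num.min (d / 2) r.
have u0 : 0 < u by rewrite lt_min r0 divr_gt0.
have uE : nrm (u%:C : C) = u by rewrite nrmR gtr0_norm.
have ud : u < d by rewrite gt_min; apply/orP; left; lra.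
have := hd u%:C; rewrite subr0 uE => /(_ ud).
have := allbut u%:C; have -> : u%:C != 0 :> C.
  by apply: contraTneq u0 => h; rewrite -uE h nrm0 ltxx.
have -> : cmax (u%:C : C) <= r.
  by rewrite (le_trans (cmax_le_nrm _)) // uE ge_min lexx orbT.
move=> /(_ isT isT) h1 h2; have := nrmD (q 0 - q u%:C) (q u%:C).
by rewrite subrK nrmBC; lra.
Qed.

(** The second divided difference in [t] is differentiable and bounded as a
    function of [s]; the Cauchy estimate in [s] gives the factor [nrm s]. *)
Lemma mixed_difference (F : C -> C -> C) (r M : R) : 0 < r ->
  (forall s t, cmax s <= r -> cmax t <= r -> cdiff (F^~ t) s) ->
  (forall s t, cmax s <= r -> cmax t <= r -> cdiff (F s) t) ->
  (forall s t, cmax s <= r -> cmax t <= r -> nrm (F s t) <= M) ->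
  forall s t t', t != 0 -> t' != 0 ->
  cmax s <= r / 8 -> cmax t <= r / 8 -> cmax t' <= r / 8 ->
  nrm ((F s t - F s 0 - (F 0 t - F 0 0)) / t - (F s t' - F s 0 - (F 0 t' - F 0 0)) / t')
    <= 1024 * M / r ^+ 3 * nrm (t - t') * nrm s.
Proof.
move=> r0 d1 d2 FM s t t' t0 t'0 hs ht ht'.
pose G s := (F s t - F s 0) / t - (F s t' - F s 0) / t'.
have c0 : cmax (0 : C) <= r by rewrite cmax0 ltW.
have tr : cmax t <= r by lra.
have tr' : cmax t' <= r by lra.
have -> : (F s t - F s 0 - (F 0 t - F 0 0)) / t -
    (F s t' - F s 0 - (F 0 t' - F 0 0)) / t' = G s - G 0.
  by rewrite /G; field; rewrite t0 t'0.
have dG z : cmax z <= r -> cdiff G z.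
  move=> hz; apply: cdiffB; apply: cdiffM; try exact: cdiff_cst.
    by apply: cdiffB; apply: d1.
  by apply: cdiffB; apply: d1.
have GM z : cmax z <= r -> nrm (G z) <= 128 * M / r ^+ 2 * nrm (t - t').
  move=> hz; apply: (cauchy_divided_lipschitz r0 _ _ t0 t'0 ht ht') => w hw; first exact: d2.
  exact: FM.
have hp (u : C) : cmax u <= r / 8 -> u != r%:C.
  move=> hu; apply: contraTneq hu => ->.
  by rewrite -ltNge /cmax /= normr0 gtr0_norm // max_l ?(ltW r0) //; lra.
have h0 : cmax (0 : C) <= r / 8 by rewrite cmax0; lra.
have hcl := cauchy_lipschitz r0 (fun z hz => cdiff_continuous (dG z hz))
  (fun z hz _ => dG z hz) GM (hp _ hs) (hp _ h0) hs h0.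
rewrite subr0 in hcl; apply: (le_trans hcl).
rewrite le_eqVlt; apply/orP; left; apply/eqP; field; exact: lt0r_neq0.
Qed.

End Estimates.

(** * Inner products and the Cauchy-Schwarz inequality *)

Section Dot.
Context {R : realType}.
Local Notation C := R[i].

Lemma nrmJ (z : C) : nrm (Num.conj z) = nrm z.
Proof. by rewrite /nrm norm_conjC. Qed.

Variables (H : normedModType C) (dot : {dot H for Num.conj}).
Hypothesis ip : inner_product dot.
Implicit Types (x y z : H) (a : C).

Lemma dotC x y : dot x y = Num.conj (dot y x).
Proof. by rewrite (hermC dot x y) /= expr0 mul1r. Qed.

Lemma dotDl x y z : dot (x + y) z = dot x z + dot y z.
Proof. by rewrite linearDl. Qed.
Lemma dotBl x y z : dot (x - y) z = dot x z - dot y z.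
Proof. by rewrite linearBl. Qed.
Lemma dotZl a x y : dot (a *: x) y = a * dot x y.
Proof. by rewrite linearZl_LR. Qed.
Lemma dotDr x y z : dot x (y + z) = dot x y + dot x z.
Proof. by rewrite linearD. Qed.
Lemma dotBr x y z : dot x (y - z) = dot x y - dot x z.
Proof. by rewrite linearB. Qed.
Lemma dotZr a x y : dot x (a *: y) = Num.conj a * dot x y.
Proof. by rewrite linearZ. Qed.
Lemma dot0l x : dot 0 x = 0.
Proof. by rewrite linear0l. Qed.
Lemma dot0r x : dot x 0 = 0.
Proof. by rewrite linear0. Qed.

Lemma dot_suml I (s : seq I) (P : pred I) (F : I -> H) y :
  dot (\sum_(i <- s | P i) F i) y = \sum_(i <- s | P i) dot (F i) y.
Proof.
by elim/big_rec2: _ => [|i a b _ IH]; rewrite ?dot0l // dotDl IH.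
Qed.

Lemma dot_sumr I (s : seq I) (P : pred I) (F : I -> H) y :
  dot y (\sum_(i <- s | P i) F i) = \sum_(i <- s | P i) dot y (F i).
Proof.
by elim/big_rec2: _ => [|i a b _ IH]; rewrite ?dot0r // dotDr IH.
Qed.

Lemma dotxx x : dot x x = (nrm x ^+ 2)%:C.
Proof. by rewrite -ip nrmE rmorphXn. Qed.

(** Pythagoras for the component of [x] orthogonal to [y]. *)
Lemma cauchy_schwarz_identity x y : y != 0 ->
  nrm x ^+ 2 * nrm y ^+ 2 =
  nrm (x - (dot x y / dot y y) *: y) ^+ 2 * nrm y ^+ 2 + nrm (dot x y) ^+ 2.
Proof.
move=> y0; have ny : nrm y != 0 by rewrite gt_eqF // nrm_gt0.
set a := dot x y / dot y y; set u := x - a *: y.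
have yy : dot y y != 0.
  by rewrite dotxx -(rmorph0 (real_complex R)) (inj_eq (@complexI R)) expf_neq0.
have uy : dot u y = 0 by rewrite dotBl dotZl /a divfK // subrr.
have yu : dot y u = 0 by rewrite dotC uy rmorph0.
have xE : x = u + a *: y by rewrite /u subrK.
have e2 : nrm (dot x y) = nrm a * nrm y ^+ 2.
  rewrite -[in LHS](divfK yy (dot x y)) -/a nrmM dotxx nrmR ger0_norm //.
  exact: exprn_ge0 (nrm_ge0 _).
clearbody a u.
have e1 : nrm x ^+ 2 = nrm u ^+ 2 + nrm a ^+ 2 * nrm y ^+ 2.
  suff : (nrm x ^+ 2)%:C = (nrm u ^+ 2 + nrm a ^+ 2 * nrm y ^+ 2)%:C :> C.
    by move/complexI.
  transitivity ((nrm u ^+ 2)%:C + (nrm a ^+ 2)%:C * (nrm y ^+ 2)%:C); last first.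
    by rewrite -rmorphM -rmorphD.
  rewrite -dotxx {1 2}xE !(dotDl, dotDr, dotZl, dotZr) uy yu.
  rewrite !mulr0 addr0 add0r !dotxx; congr (_ + _).
  by rewrite mulrA; congr (_ * _); rewrite -normCK nrmE rmorphXn.
by rewrite e1 e2; ring.
Qed.

Lemma cauchy_schwarz x y : nrm (dot x y) <= nrm x * nrm y.
Proof.
have [->|y0] := eqVneq y 0; first by rewrite dot0r !nrm0 mulr0.
rewrite -ler_sqr ?nnegrE ?mulr_ge0 ?nrm_ge0 // exprMn cauchy_schwarz_identity //.
by rewrite lerDr mulr_ge0 // exprn_ge0 // nrm_ge0.
Qed.

Lemma cauchy_schwarz_lt x y : y != 0 -> (forall a, x != a *: y) ->
  nrm (dot x y) ^+ 2 < nrm x ^+ 2 * nrm y ^+ 2.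
Proof.
move=> y0 xy; rewrite cauchy_schwarz_identity // ltrDr mulr_gt0 //.
  by apply: exprn_gt0; apply: nrm_gt0; rewrite subr_eq0; exact: xy.
by apply: exprn_gt0; exact: nrm_gt0.
Qed.

(** For [y = x] the hypothesis is an inequality for the square of the norm. *)
Lemma nrm_dual x k : 0 <= k -> (forall y, nrm (dot x y) <= k * nrm y) -> nrm x <= k.
Proof.
move=> k0 h; have [->|x0] := eqVneq x 0; first by rewrite nrm0.
have := h x; rewrite dotxx nrmR ger0_norm ?exprn_ge0 ?nrm_ge0 //.
by rewrite expr2 ler_pM2r // nrm_gt0.
Qed.

Lemma cvg_dot T (F : set_system T) (FF : Filter F) (f g : T -> H) (a b : H) :
  f @ F --> a -> g @ F --> b -> dot (f t) (g t) @[t --> F] --> dot a b.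
Proof.
move=> fa gb; apply/cvg_nrmP => e e0.
have b0 : 0 < nrm b + 1 by rewrite ltr_wpDl ?nrm_ge0.
have a0 : 0 < nrm a + 1 by rewrite ltr_wpDl ?nrm_ge0.
move/cvg_nrmP : (fa) => /(_ (e / 2 / (nrm b + 1))).
rewrite !divr_gt0 // => /(_ isT) f1.
move/cvg_nrmP : (gb) => /(_ (e / 2 / (nrm a + 1))).
rewrite !divr_gt0 // => /(_ isT) g1.
move/cvg_nrmP : (gb) => /(_ 1 ltr01) g2.
apply: filterS3 f1 g1 g2 => t f1 g1 g2.
have -> : dot (f t) (g t) - dot a b = dot (f t - a) (g t) + dot a (g t - b).
  by rewrite dotBl dotBr addrA subrK.
rewrite (le_lt_trans (nrmD _ _)) //.
have gt : nrm (g t) <= nrm b + 1.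
  rewrite -[g t](subrK b) (le_trans (nrmD _ _)) // addrC lerD2l ltW //.
rewrite [e]splitr; apply: ltr_leD.
  apply: (le_lt_trans (cauchy_schwarz _ _)).
  rewrite ltr_pdivlMr // in f1; apply: le_lt_trans f1.
  by apply: ler_wpM2l; rewrite ?nrm_ge0.
apply: (le_trans (cauchy_schwarz _ _)).
rewrite ltr_pdivlMr // mulrC in g1; apply: le_trans (ltW g1).
by apply: ler_wpM2r; rewrite ?nrm_ge0 // lerDl.
Qed.

End Dot.

(** * Frechet differentials in epsilon form *)

Section Frechet.
Context {R : realType}.
Local Notation C := R[i].
Variables (V W : normedModType C).

Lemma differentiable_eps (f : V -> W) (x : V) : differentiable f x ->
  forall e : R, 0 < e -> exists2 d : R, 0 < d &
    forall h, nrm h < d -> nrm (f (x + h) - f x - 'd f x h) <= e * nrm h.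
Proof.
move=> /diff_locallyP [cdf /eqaddoP df] e e0.
have e0' : (0 : C) < e%:C by rewrite ltcR.
have /nbhs_nrmP [d d0 hd] := df _ e0'.
exists d => // h hh; have := hd h; rewrite subr0 => /(_ hh).
rewrite !nrmE -rmorphM lecR.
have -> : nrm ((f \o shift x - (cst (f x) + 'd f x)) h) =
  nrm (f (h + x) - (f x + 'd f x h)) by [].
by rewrite [h + x]addrC opprD addrA.
Qed.

Lemma directional_eps (g : V -> W) (p u : V) : differentiable g p ->
  forall e : R, 0 < e -> exists2 d : R, 0 < d & forall s : C, nrm s < d ->
    nrm (g (p + s *: u) - g p - s *: 'd g p u) <= e * nrm s.
Proof.
move=> dg e e0; have u0 : 0 < nrm u + 1 by rewrite ltr_wpDl ?nrm_ge0.
have e1 : 0 < e / (nrm u + 1) by rewrite divr_gt0.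
have [d d0 hd] := differentiable_eps dg e1.
exists (d / (nrm u + 1)); first by rewrite divr_gt0.
move=> s hs; have hh : nrm (s *: u) < d.
  rewrite nrmZ; rewrite ltr_pdivlMr // in hs; apply: le_lt_trans hs.
  by rewrite ler_wpM2l ?nrm_ge0 // lerDl.
have := hd _ hh; rewrite linearZ => hb; apply: (le_trans hb).
rewrite nrmZ.
have -> : e / (nrm u + 1) * (nrm s * nrm u) = e * nrm s * (nrm u / (nrm u + 1)).
  by field; rewrite gt_eqF.
rewrite ler_piMr ?mulr_ge0 ?nrm_ge0 ?(ltW e0) //.
by rewrite ler_pdivrMr // mul1r lerDl.
Qed.

(** Two continuous linear maps that agree up to o(h) are equal. *)
Lemma differentiable_of_eps (f : V -> W) (x : V) (L : {linear V -> W}) :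
  continuous L ->
  (forall e : R, 0 < e -> exists2 d : R, 0 < d &
    forall h, nrm h < d -> nrm (f (x + h) - f x - L h) <= e * nrm h) ->
  differentiable f x /\ 'd f x = L :> (V -> W).
Proof.
move=> cL H.
have E : f \o shift x = cst (f x) + L +o_ 0 id.
  apply/eqaddoP => e e0; have := gtr0_real e0 => /complex_realP [r er]; subst e.
  rewrite ltcR in e0; have [d d0 hd] := H r e0.
  apply/nbhs_nrmP; exists d => // h; rewrite subr0 => /hd.
  have -> : (f \o shift x - (cst (f x) + L)) h = f (h + x) - (f x + L h) by [].
  by rewrite !nrmE -rmorphM lecR [h + x]addrC opprD addrA.
have D := diff_unique cL E; split=> //; apply/diff_locallyP; rewrite D; split=> //.
Qed.

End Frechet.

(** * Second derivatives of holomorphic maps into a Hilbert space *)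

Section Complete.
Context {R : realType}.
Local Notation C := R[i].

Lemma complete_cvg (H : completeNormedModType C) (F : set_system H)
    (PF : ProperFilter F) :
  (forall e : R, 0 < e -> exists x, F [set y | nrm (y - x) < e]) ->
  exists l : H, F --> l.
Proof.
move=> HF; suff /cauchy_cvg : cauchy F by move=> h; exists (lim F).
apply: cauchy_exP => e e0; have := gtr0_real e0 => /complex_realP [r er]; subst e.
rewrite ltcR in e0; have [x hx] := HF r e0; exists x.
apply: filterS hx => y /= hy; rewrite -ball_normE /= distrC nrmE ltcR //.
Qed.

End Complete.

Section SecondDerivative.
Context {R : realType}.
Local Notation C := R[i].
Variables (V : normedModType C) (H : completeNormedModType C).
Variables (dot : {dot H for Num.conj}).
Hypothesis ip : inner_product dot.

(** Restricted to a complex line and paired with a vector, a holomorphic map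
    becomes a differentiable scalar function. *)
Lemma cdiff_slice (g : V -> H) (p u : V) (x : H) (s : C) :
  differentiable g (p + s *: u) -> cdiff (fun s => dot (g (p + s *: u)) x) s.
Proof.
move=> dg; set q := p + s *: u in dg.
pose phi s' := if s' == s then dot ('d g q u) x else
  (dot (g (p + s' *: u)) x - dot (g q) x) / (s' - s).
exists phi; split; last first.
  move=> s'; rewrite /phi; case: eqP => [->|/eqP ne]; first by rewrite subrr mul0r addr0.
  by rewrite mulrC divfK ?subr_eq0 // [RHS]addrC subrK.
apply/continuous_epsP => e e0.
have A0 : 0 < (nrm u + 1) * (nrm x + 1) by rewrite mulr_gt0 // ltr_wpDl ?nrm_ge0.
have e1 : 0 < e / 2 / ((nrm u + 1) * (nrm x + 1)) by rewrite !divr_gt0.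
have [d d0 hd] := differentiable_eps dg e1.
have u0 : 0 < nrm u + 1 by rewrite ltr_wpDl ?nrm_ge0.
exists (d / (nrm u + 1)); first by rewrite divr_gt0.
move=> s' hs'; rewrite /phi eqxx; case: eqP => [_|/eqP ne].
  by rewrite subrr nrm0.
have ns : 0 < nrm (s' - s) by rewrite nrm_gt0 // subr_eq0.
have hh : nrm ((s' - s) *: u) < d.
  rewrite nrmZ; rewrite ltr_pdivlMr // in hs'; apply: le_lt_trans hs'.
  by rewrite ler_wpM2l ?nrm_ge0 // lerDl.
have {hd} := hd _ hh; have -> : q + (s' - s) *: u = p + s' *: u.
  by rewrite /q scalerBl addrA [p + _ + _]addrAC addrK.
rewrite linearZ => hd.
have -> : (dot (g (p + s' *: u)) x - dot (g q) x) / (s' - s) - dot ('d g q u) x =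
  dot (g (p + s' *: u) - g q - (s' - s) *: 'd g q u) x / (s' - s).
  rewrite !dotBl dotZl; field; by rewrite subr_eq0.
rewrite nrmM nrmV ltr_pdivrMr //.
apply: (le_lt_trans (cauchy_schwarz ip _ _)).
rewrite nrmZ in hd.
apply: (@le_lt_trans _ _ (e / 2 * nrm (s' - s))); last first.
  by rewrite ltr_pM2r // ltr_pdivrMr // ltr_pMr // ltr1n.
apply: (le_trans (ler_wpM2r (nrm_ge0 _) hd)).
set a := nrm u; set b := nrm x; set n := nrm (s' - s).
have -> : e / 2 / ((a + 1) * (b + 1)) * (n * a) * b =
    e / 2 * n * (a * b / ((a + 1) * (b + 1))).
  by field; rewrite !gt_eqF // ltr_wpDl ?nrm_ge0.
rewrite ler_piMr // ?mulr_ge0 ?nrm_ge0 ?(ltW e0) ?invr_ge0 //.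
by rewrite ler_pdivrMr // mul1r ler_pM ?nrm_ge0 // lerDl.
Qed.

(** [mixed_difference] for each pairing with a vector, with a constant
    proportional to the norm of the vector. *)
Lemma second_difference_bound (g : V -> H) (p u v : V) (r M : R) : 0 < r ->
  (forall s t : C, cmax s <= r -> cmax t <= r ->
     differentiable g (p + s *: u + t *: v) /\ nrm (g (p + s *: u + t *: v)) <= M) ->
  let D s t := g (p + s *: u + t *: v) - g (p + s *: u) - (g (p + t *: v) - g p) in
  forall s t t' : C, t != 0 -> t' != 0 ->
  cmax s <= r / 8 -> cmax t <= r / 8 -> cmax t' <= r / 8 ->
  nrm (t^-1 *: D s t - t'^-1 *: D s t') <=
    1024 * M / r ^+ 3 * nrm (t - t') * nrm s.
Proof.
move=> r0 hg D s t t' t0 t'0 hs ht ht'.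
have c0 : cmax (0 : C) <= r by rewrite cmax0 ltW.
have M0 : 0 <= M by apply: le_trans (hg 0 0 c0 c0).2; exact: nrm_ge0.
have k0 : 0 <= 1024 * M / r ^+ 3 * nrm (t - t') * nrm s.
  apply: mulr_ge0 (nrm_ge0 _); apply: mulr_ge0 (nrm_ge0 _).
  apply: divr_ge0; last by apply: exprn_ge0; exact: ltW.
  by apply: mulr_ge0 M0; exact: ler0n.
apply: (nrm_dual ip k0) => x.
pose F s t := dot (g (p + s *: u + t *: v)) x.
have E1 : (F s t - F s 0 - (F 0 t - F 0 0)) / t -
   (F s t' - F s 0 - (F 0 t' - F 0 0)) / t' = dot (t^-1 *: D s t - t'^-1 *: D s t') x.
  rewrite /F.
  rewrite /D.
  rewrite !scale0r !addr0.
  rewrite !(dotBl, dotZl).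
  ring.
have E2 : 1024 * (M * nrm x) / r ^+ 3 * nrm (t - t') * nrm s =
  1024 * M / r ^+ 3 * nrm (t - t') * nrm s * nrm x by ring.
rewrite -E1 -E2.
apply: (@mixed_difference R F r (M * nrm x) r0 _ _ _ s t t' t0 t'0 hs ht ht') => a b ha hb.
- have [dg _] := hg a b ha hb; rewrite /F.
  have -> : (fun s0 => dot (g (p + s0 *: u + b *: v)) x) =
    fun s0 => dot (g ((p + b *: v) + s0 *: u)) x.
    by apply/funext => s0; rewrite addrAC.
  by apply: cdiff_slice; rewrite addrAC.
- by have [dg _] := hg a b ha hb; apply: cdiff_slice.
have [_ gM] := hg a b ha hb.
apply: (le_trans (cauchy_schwarz ip _ _)).
by apply: ler_wpM2r; rewrite ?nrm_ge0.
Qed.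


Lemma subrACA (W : zmodType) (a b c d : W) : (a - b) - (c - d) = (a - c) - (b - d).
Proof. by rewrite !opprB !addrA -!(addrAC _ d) -!addrA [- b - c]addrC. Qed.

(** The difference quotients of the derivative are expressed by second
    differences and the three remainders of first-order expansions. *)
Lemma second_difference_algebra (W : lmodType C) (S t t' : C)
    (G0 G1 G2 Gs G1s G2s c0 c1 c2 : W) :
  S *: (t^-1 *: (c1 - c0) - t'^-1 *: (c2 - c0)) =
  (t^-1 *: (G1s - Gs - (G1 - G0)) - t'^-1 *: (G2s - Gs - (G2 - G0)))
  - t^-1 *: ((G1s - G1 - S *: c1) - (Gs - G0 - S *: c0))
  + t'^-1 *: ((G2s - G2 - S *: c2) - (Gs - G0 - S *: c0)).
Proof.
have key (x y d : W) : x - Gs - (y - G0) -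
    ((x - y - S *: d) - (Gs - G0 - S *: c0)) = S *: (d - c0).
  rewrite [x - y - S *: d - _]subrACA [x - Gs - _]subrACA.
  by set A := x - y - _; rewrite [- (A - _)]opprB addrC subrK scalerBr.
rewrite scalerBr !scalerA ![S * _]mulrC -!scalerA.
rewrite -(key G1s G1 c1) -(key G2s G2 c2).
move: (_ - _ - (G1 - G0)) (_ - _ - (G2 - G0)) => X1 X2.
move: (_ - (Gs - G0 - _)) (_ - (Gs - G0 - _)) => Y1 Y2.
by rewrite !scalerBr subrACA opprB addrA addrAC.
Qed.

(** Let [s] tend to 0 in [second_difference_bound], after division by [s]. *)
Lemma derivative_quotient_lipschitz (g : V -> H) (p u v : V) (r M : R) : 0 < r ->
  (forall s t : C, cmax s <= r -> cmax t <= r ->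
     differentiable g (p + s *: u + t *: v) /\ nrm (g (p + s *: u + t *: v)) <= M) ->
  let Q t := t^-1 *: ('d g (p + t *: v) u - 'd g p u) in
  forall t t' : C, t != 0 -> t' != 0 -> cmax t <= r / 8 -> cmax t' <= r / 8 ->
  nrm (Q t - Q t') <= 1024 * M / r ^+ 3 * nrm (t - t').
Proof.
move=> r0 hg Q t t' t0 t'0 ht ht'.
have c0 : cmax (0 : C) <= r by rewrite cmax0 ltW.
have dgt w : cmax w <= r -> differentiable g (p + w *: v).
  by move=> hw; have [] := hg 0 w c0 hw; rewrite scale0r addr0.
have dt := dgt t _; have dt' := dgt t' _; have dp := dgt 0 c0.
rewrite scale0r addr0 in dp.
have {}dt : differentiable g (p + t *: v) by apply: dt; lra.
have {}dt' : differentiable g (p + t' *: v) by apply: dt'; lra.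
pose N := 2 * (nrm t^-1 + nrm t'^-1).
have N0 : 0 < N by rewrite mulr_gt0 // addr_gt0 // nrm_gt0 // invr_eq0.
apply/ler_addgt0Pr => e e0.
have e1 : 0 < e / N by rewrite divr_gt0.
have [d1 d10 h1] := directional_eps u dt e1.
have [d2 d20 h2] := directional_eps u dt' e1.
have [d3 d30 h3] := directional_eps u dp e1.
pose s0 := Num.min (r / 8) (Num.min (d1 / 2) (Num.min (d2 / 2) (d3 / 2))).
have s00 : 0 < s0 by rewrite !lt_min !divr_gt0.
have [sr s1 s2 s3] : [/\ s0 <= r / 8, s0 < d1, s0 < d2 & s0 < d3].
  by split; rewrite /s0 ?ge_min ?gt_min ?lexx //; lra.
have ns : nrm (s0%:C : C) = s0 by rewrite nrmR gtr0_norm.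
have hs : cmax (s0%:C : C) <= r / 8 by apply: le_trans (cmax_le_nrm _) _; rewrite ns.
rewrite -(ler_pM2l s00).
have := second_difference_bound r0 hg t0 t'0 hs ht ht'; cbv zeta; rewrite ns => hD.
have {}h1 := h1 s0%:C; have {}h2 := h2 s0%:C; have {}h3 := h3 s0%:C.
rewrite ns in h1 h2 h3; have {}h1 := h1 s1; have {}h2 := h2 s2; have {}h3 := h3 s3.
rewrite -{1}ns -nrmZ.
move: hD h1 h2 h3; rewrite addrAC [in X in X -> _ -> _ -> _]addrAC.
set S := s0%:C; set G0 := g p; set G1 := g (p + t *: v); set G2 := g (p + t' *: v).
rewrite [p + t *: v + S *: u]addrAC [p + t' *: v + S *: u]addrAC.
set K := 1024 * M / r ^+ 3 * nrm (t - t').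
set c1 := 'd g _ u; set c2 := 'd g (p + t' *: v) u; set c3 := 'd g p u.
move=> hD h1 h2 h3.
rewrite (second_difference_algebra S t t' G0 G1 G2 (g (p + S *: u))
  (g (p + S *: u + t *: v)) (g (p + S *: u + t' *: v)) c3 c1 c2).
have a0 : 0 <= nrm t^-1 := nrm_ge0 _; have b0 : 0 <= nrm t'^-1 := nrm_ge0 _.
have -> : s0 * (K + e) = K * s0 + nrm t^-1 * (e / N * s0 + e / N * s0) +
    nrm t'^-1 * (e / N * s0 + e / N * s0).
  have NE : N = 2 * (nrm t^-1 + nrm t'^-1) by [].
  have sum0 : nrm t^-1 + nrm t'^-1 != 0.
    by apply: contraTneq N0; rewrite NE => ->; rewrite mulr0 ltxx.
  by rewrite NE; field.
rewrite (le_trans (nrmD _ _)) //; apply: lerD; last first.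
  rewrite nrmZ; apply: ler_wpM2l => //; rewrite (le_trans (nrmB _ _)) //.
  exact: lerD.
rewrite (le_trans (nrmB _ _)) //; apply: lerD; first exact: hD.
rewrite nrmZ; apply: ler_wpM2l => //; rewrite (le_trans (nrmB _ _)) //.
exact: lerD.
Qed.

(** The difference quotients of the derivative are Lipschitz functions of the
    increment, hence converge in a complete space. *)
Lemma second_derivative (D0 : set V) (g : V -> H) (p u v : V) : open D0 -> D0 p ->
  (forall z, D0 z -> differentiable g z) ->
  exists B : H, (fun t : C => t^-1 *: ('d g (p + t *: v) u - 'd g p u)) @ 0^' --> B.
Proof.
move=> oD Dp dg; have [d d0 hd] := (nbhs_nrmP p D0).1 (open_nbhs_nbhs (conj oD Dp)).
have cg : {for p, continuous g} by apply: differentiable_continuous; apply: dg.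
have [d' d0' hd'] := (continuous_epsP g p).1 cg 1 ltr01.
pose n := nrm u + nrm v + 1; have n0 : 0 < n by rewrite ltr_wpDl // addr_ge0 ?nrm_ge0.
pose r := Num.min d d' / (2 * n).
have r0 : 0 < r by rewrite divr_gt0 ?mulr_gt0 // lt_min d0.
pose M := nrm (g p) + 1.
have hg (s t : C) : cmax s <= r -> cmax t <= r ->
     differentiable g (p + s *: u + t *: v) /\ nrm (g (p + s *: u + t *: v)) <= M.
  move=> hs ht.
  have close : nrm (p + s *: u + t *: v - p) < Num.min d d'.
    have -> : p + s *: u + t *: v - p = s *: u + t *: v.
      by rewrite addrAC [p + _]addrC addrK.
    rewrite (le_lt_trans (nrmD _ _)) // !nrmZ.
    have ns : nrm s <= 2 * r by rewrite (le_trans (nrm_le_cmax _)) // ler_pM2l.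
    have nt : nrm t <= 2 * r by rewrite (le_trans (nrm_le_cmax _)) // ler_pM2l.
    have -> : Num.min d d' = 2 * r * n by rewrite /r; field; rewrite gt_eqF.
    rewrite /n 2!mulrDr mulr1 (@le_lt_trans _ _ (2 * r * nrm u + 2 * r * nrm v)) //.
      by apply: lerD; apply: ler_wpM2r; rewrite ?nrm_ge0.
    by rewrite ltrDl mulr_gt0.
  move: close; rewrite lt_min => /andP[c1 c2]; split; first by apply/dg/hd.
  rewrite -[g _](subrK (g p)) (le_trans (nrmD _ _)) // addrC lerD2l.
  exact: ltW (hd' _ c2).
have lip := derivative_quotient_lipschitz r0 hg; cbv zeta in lip.
set Q := fun t : C => _ in lip *.
pose K := 1024 * M / r ^+ 3.
have M0 : 0 <= M by rewrite addr_ge0 ?nrm_ge0.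
have K0 : 0 <= K.
  by apply: divr_ge0; [apply: mulr_ge0 M0; exact: ler0n|apply: exprn_ge0; exact: ltW].
apply: complete_cvg => e e0.
pose d1 := Num.min (r / 8) (e / (2 * (K + 1))).
have K1 : 0 < K + 1 by rewrite ltr_wpDl.
have d10 : 0 < d1.
  by rewrite lt_min; apply/andP; split;
    [exact: divr_gt0 r0 (ltr0n _ 8)|exact: divr_gt0 e0 (mulr_gt0 (ltr0n _ 2) K1)].
have t0 : 0 < d1 / 2 by rewrite divr_gt0.
have nt : nrm ((d1 / 2)%:C : C) = d1 / 2 by rewrite nrmR gtr0_norm.
exists (Q (d1 / 2)%:C); apply/dnbhs_nrmP; exists (d1 / 2) => // t tn0.
rewrite subr0 => ht; rewrite /=.
have h8 (w : C) : nrm w <= d1 / 2 -> cmax w <= r / 8.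
  move=> hw; rewrite (le_trans (cmax_le_nrm _)) // (le_trans hw) //.
  apply: (@le_trans _ _ d1); first by lra.
  by rewrite ge_min lexx.
apply: (le_lt_trans (lip t (d1 / 2)%:C tn0 _ (h8 _ (ltW ht)) (h8 _ _))).
- by apply: contraTneq t0 => h; rewrite -nt h nrm0 ltxx.
- by rewrite nt.
rewrite -/K (@le_lt_trans _ _ (K * d1)) //.
  rewrite ler_wpM2l // (le_trans (nrmB _ _)) // nt; lra.
apply: (@lt_le_trans _ _ ((K + 1) * d1)); first by rewrite ltr_pM2r // ltrDl.
apply: (@le_trans _ _ ((K + 1) * (e / (2 * (K + 1))))).
  by rewrite ler_pM2l // ge_min lexx orbT.
have -> : (K + 1) * (e / (2 * (K + 1))) = e / 2 by field; rewrite gt_eqF.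
by rewrite ler_pdivrMr // ler_pMr // ler1n.
Qed.

End SecondDerivative.

(** * Derivatives along real lines *)

Section RealDerivative.
Context {R : realType}.
Local Notation C := R[i].

(** The increments are real, while the module has complex scalars. *)
Definition rderiv (V : normedModType C) (c : R -> V) (a : V) : Prop :=
  (fun t : R => (t^-1)%:C *: (c t - c 0)) @ (0 : R)^' --> a.

Lemma rderiv_cont (V : normedModType C) (c : R -> V) a :
  rderiv c a -> c @ (0 : R)^' --> c 0.
Proof.
move=> h; have h0 : (fun t : R => t%:C *: ((t^-1)%:C *: (c t - c 0)) + c 0) @ (0 : R)^' --> c 0.
  rewrite -[X in _ --> X](add0r (c 0)); apply: cvgD; last exact: cvg_cst.
  rewrite -(scale0r a); apply: cvgZ; last exact: h.
  by apply: cvg_within_filter; exact: (@realC_continuous R 0).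
apply: cvg_trans h0; apply: near_eq_cvg; apply/dnbhsRP; exists 1 => // t t0 _.
by rewrite scalerA -rmorphM mulfV // scale1r subrK.
Qed.

Lemma rderiv_near (V : normedModType C) (c d : R -> V) a (e : R) : 0 < e ->
  (forall t, `|t| < e -> c t = d t) -> rderiv c a -> rderiv d a.
Proof.
move=> e0 cd; apply: cvg_trans; apply: near_eq_cvg.
apply/dnbhsRP; exists e => // t _; rewrite subr0 => te.
by rewrite !cd // normr0.
Qed.

Lemma rderiv_dot (H : normedModType C) (dot : {dot H for Num.conj})
  (ip : inner_product dot) (c d : R -> H) a b : rderiv c a -> rderiv d b ->
  rderiv (fun t => dot (c t) (d t) : C) (dot a (d 0) + dot (c 0) b).
Proof.
move=> hc hd; rewrite /rderiv.
have -> : (fun t : R => (t^-1)%:C *: ((dot (c t) (d t) : C) - dot (c 0) (d 0))) =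
    fun t => (dot ((t^-1)%:C *: (c t - c 0)) (d t) : C) +
             dot (c 0) ((t^-1)%:C *: (d t - d 0)).
  apply/funext => t; rewrite !(dotZl, dotZr, dotBl, dotBr).
  have -> : Num.conj (t^-1)%:C = (t^-1)%:C :> C by exact: conjc_real.
  by rewrite /GRing.scale /=; ring.
apply: cvgD; first exact: cvg_dot hc (rderiv_cont hd).
by apply: cvg_dot hd => //; exact: cvg_cst.
Qed.

Lemma rderiv_quot (A N : R -> C) a n : N 0 != 0 -> rderiv A a -> rderiv N n ->
  rderiv (fun t => A t / N t) ((a * N 0 - A 0 * n) / N 0 ^+ 2).
Proof.
move=> N0 hA hN; rewrite /rderiv.
have cN := rderiv_cont hN.
have NN : N 0 * N 0 != 0 by rewrite mulf_neq0.
have E : (fun t : R => ((t^-1)%:C *: (A t - A 0) * N 0 - A 0 * ((t^-1)%:C *: (N t - N 0)))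
    / (N t * N 0)) @ (0 : R)^' --> (a * N 0 - A 0 * n) / N 0 ^+ 2.
  apply: cvgM; last first.
    apply: cvgV; first by rewrite expr2.
    by rewrite expr2; apply: cvgM; [exact: cN|exact: cvg_cst].
  apply: cvgB; first by apply: cvgM; [exact: hA|exact: cvg_cst].
  by apply: cvgM; [exact: cvg_cst|exact: hN].
apply: cvg_trans E; apply: near_eq_cvg.
move/cvg_nrmP : cN => /(_ (nrm (N 0)) (nrm_gt0 N0)) hN0.
apply: filterS hN0 => t ht.
have Nt : N t != 0.
  by apply: contraTneq ht => ->; rewrite sub0r nrmN ltxx.
by rewrite /GRing.scale /=; move: (t^-1)%:C => k; field; rewrite Nt N0.
Qed.

Lemma rderiv_derive1 (c : R -> C) (a : C) : rderiv c a ->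
  derive1 (fun t => complex.Re (c t)) 0 = complex.Re a /\
  derive1 (fun t => complex.Im (c t)) 0 = complex.Im a.
Proof.
move=> h; split; rewrite /derive1; apply: cvg_lim => //.
- have -> : (fun h : R => h^-1 *: (complex.Re (c (h + 0)) - complex.Re (c 0))) =
     fun t => complex.Re ((t^-1)%:C * (c t - c 0)).
    by apply/funext => t; rewrite addr0 cReM ReB /= mul0r subr0.
  by apply: (cvg_comp _ _ h); exact: Re_continuous.
- have -> : (fun h : R => h^-1 *: (complex.Im (c (h + 0)) - complex.Im (c 0))) =
     fun t => complex.Im ((t^-1)%:C * (c t - c 0)).
    by apply/funext => t; rewrite addr0 cImM ImB /= mul0r addr0.
  by apply: (cvg_comp _ _ h); exact: Im_continuous.
Qed.

Lemma rderiv_real_derive m (f : 'rV[C]_m -> C) v z a :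
  rderiv (fun t : R => f (z + t%:C *: v)) a -> real_derive f v z = a.
Proof.
by move=> /rderiv_derive1 [h1 h2]; rewrite /real_derive h1 h2; case: a {h1 h2}.
Qed.

Lemma rderiv_is_derive (n : R -> R) (k : R) : rderiv (fun t => (n t)%:C : C) k%:C ->
  is_derive (0 : R) (1 : R) n k.
Proof.
move=> h; have E : (fun h : R => h^-1 *: (n (h *: 1 + 0) - n 0)) @ (0 : R)^' --> k.
  have -> : (fun h : R => h^-1 *: (n (h *: 1 + 0) - n 0)) =
     fun t => complex.Re ((t^-1)%:C * ((n t)%:C - (n 0)%:C)).
    by apply/funext => t; rewrite addr0 [t *: 1]mulr1 cReM ReB /= mul0r subr0.
  exact: (cvg_comp _ _ h (@Re_continuous R k%:C)).
apply: DeriveDef; first by apply/cvg_ex; exists k.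
exact: cvg_lim E.
Qed.

Lemma ln_derive (n : R -> R) (k : R) : 0 < n 0 ->
  rderiv (fun t => (n t)%:C : C) k%:C -> derive1 (fun t => ln (n t)) 0 = k / n 0.
Proof.
move=> n0 /rderiv_is_derive dn.
have dl := is_derive1_ln n0.
have [_] := @is_derive1_comp R (@ln R) n 0 _ _ dl dn.
by rewrite derive1E [_ * k]mulrC => <-.
Qed.

End RealDerivative.

(** * The first antiholomorphic derivative of log |g|^2 *)

Local Open Scope sesquilinear_scope.

Section Curv.
Context {R : realType}.
Local Notation C := R[i].
Variables (H : completeNormedModType C) (dot : {dot H for Num.conj}) (m : nat).
Hypothesis ip : inner_product dot.
Variables (D0 : set 'rV[C]_m) (g : 'rV[C]_m -> H).
Hypothesis oD : open D0.
Hypothesis dg : forall z, D0 z -> differentiable g z.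
Hypothesis gn0 : forall z, D0 z -> g z != 0.

Lemma rderiv_path (V W : normedModType C) (f : V -> W) (z v : V) (a : C) :
  differentiable f z ->
  rderiv (fun t : R => f (z + t%:C *: (a *: v))) (a *: 'd f z v).
Proof.
move=> df; apply/cvg_nrmP => e e0.
have e2 : 0 < e / 2 by rewrite divr_gt0.
have [d d0 hd] := directional_eps (a *: v) df e2.
apply/dnbhsRP; exists d => // t t0; rewrite subr0 => td.
have tC : t%:C != 0 :> C by rewrite -(rmorph0 (real_complex R)) (inj_eq (@complexI R)).
have := hd t%:C; rewrite nrmR => /(_ td) hb.
rewrite -[a *: 'd f z v]linearZ scale0r addr0.
have -> : (t^-1)%:C *: (f (z + t%:C *: (a *: v)) - f z) - 'd f z (a *: v) =
  (t^-1)%:C *: (f (z + t%:C *: (a *: v)) - f z - t%:C *: 'd f z (a *: v)).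
  by rewrite [RHS]scalerBr [(t^-1)%:C *: (t%:C *: _)]scalerA -rmorphM mulVf // scale1r.
rewrite nrmZ nrmR normfV -ltr_pdivlMl ?invr_gt0 ?normr_gt0 // invrK.
apply: (le_lt_trans hb); rewrite mulrC ltr_pM2l ?normr_gt0 //.
by rewrite ltr_pdivrMr // ltr_pMr // ltr1n.
Qed.

(** A limit of difference quotients over complex increments can be taken along
    the line of real multiples of [a]. *)
Lemma rderiv_complex (V W : normedModType C) (f : V -> W) (z v : V) (a : C) B :
  a != 0 -> (fun t : C => t^-1 *: (f (z + t *: v) - f z)) @ 0^' --> B ->
  rderiv (fun t : R => f (z + t%:C *: (a *: v))) (a *: B).
Proof.
move=> a0 hB; rewrite /rderiv scale0r addr0.
have h1 : (fun t : R => (t%:C * a)^-1 *: (f (z + (t%:C * a) *: v) - f z)) @ (0:R)^' --> B.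
  apply/cvg_nrmP => e e0; have /cvg_nrmP /(_ e e0) /dnbhs_nrmP [d d0 hd] := hB.
  have na : 0 < nrm a by exact: nrm_gt0.
  apply/dnbhsRP; exists (d / nrm a); first by rewrite divr_gt0.
  move=> t t0; rewrite subr0 ltr_pdivlMr // => td; apply: hd.
    by rewrite mulf_neq0 // -(rmorph0 (real_complex R)) (inj_eq (@complexI R)).
  by rewrite subr0 nrmM nrmR.
have -> : (fun t : R => (t^-1)%:C *: (f (z + t%:C *: (a *: v)) - f z)) =
   fun t => a *: ((t%:C * a)^-1 *: (f (z + (t%:C * a) *: v) - f z)).
  apply/funext => t; rewrite !scalerA invfM mulrCA mulfV // mulr1 fmorphV //.
by apply: cvgZ; [exact: cvg_cst|exact: h1].
Qed.

Lemma addC_conj (b : C) : b + Num.conj b = (2 * complex.Re b)%:C.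
Proof.
case: b => p q; apply/eqP; rewrite eq_complex /= subrr eqxx andbT.
by apply/eqP; ring.
Qed.

Definition sqnorm (z : 'rV[C]_m) : C := dot (g z) (g z).

Lemma rderiv_sqnorm (z v : 'rV[C]_m) (a : C) : D0 z ->
  rderiv (fun t : R => sqnorm (z + t%:C *: (a *: v)))
    (2 * complex.Re (a * dot ('d g z v) (g z)))%:C.
Proof.
move=> Dz; have h := @rderiv_path _ _ g z v a (dg Dz).
have := rderiv_dot ip h h; rewrite scale0r addr0.
have -> : dot (a *: 'd g z v) (g z) + dot (g z) (a *: 'd g z v) =
    (2 * complex.Re (a * dot ('d g z v) (g z)))%:C.
  rewrite dotZl dotZr (dotC dot (g z)) -rmorphM; exact: addC_conj.
by [].
Qed.

Lemma sqnormE z : sqnorm z = (nrm (g z) ^+ 2)%:C.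
Proof. by rewrite /sqnorm dotxx. Qed.

Lemma real_derive_log (z v : 'rV[C]_m) (a : C) : D0 z ->
  real_derive (log_sqnorm g) (a *: v) z =
  (2 * complex.Re (a * dot ('d g z v) (g z)) / nrm (g z) ^+ 2)%:C.
Proof.
move=> Dz; have h := @rderiv_sqnorm z v a Dz.
have h' : rderiv (fun t : R => (nrm (g (z + t%:C *: (a *: v))) ^+ 2)%:C : C)
    (2 * complex.Re (a * dot ('d g z v) (g z)))%:C.
  by move: h; under eq_fun do rewrite sqnormE.
have n0 : 0 < nrm (g (z + (0:R)%:C *: (a *: v))) ^+ 2.
  by rewrite exprn_gt0 // nrm_gt0 // scale0r addr0 gn0.
have dl := ln_derive n0 h'.
rewrite /real_derive /log_sqnorm /=.
have -> : derive1 (fun t : R => ln (complex.Re `|g (z + t%:C *: (a *: v))| ^+ 2)) 0 =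
  2 * complex.Re (a * dot ('d g z v) (g z)) / nrm (g z) ^+ 2.
  by rewrite [LHS]dl scale0r addr0.
by rewrite derive1_cst.
Qed.

Lemma dzbar_log z j : D0 z ->
  dzbar j (log_sqnorm g) z = dot (g z) ('d g z 'e_j) / sqnorm z.
Proof.
move=> Dz; rewrite /dzbar -[X in real_derive _ X _ + _]scale1r.
rewrite !real_derive_log // mul1r sqnormE (dotC dot (g z)).
have n0 : nrm (g z) ^+ 2 != 0 by rewrite gt_eqF // exprn_gt0 // nrm_gt0 // gn0.
case: (dot ('d g z 'e_j) (g z)) => p q; move: n0; move: (nrm (g z) ^+ 2) => N N0.
rewrite -(fmorphV (real_complex R) N).
have -> : (2 : C)^-1 = (2^-1)%:C by rewrite fmorphV rmorph_nat.
by apply/eqP; rewrite eq_complex /=; apply/andP; split; apply/eqP; field.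
Qed.
End Curv.

(** * The curvature matrix of a holomorphic section *)

Section Curv2.
Context {R : realType}.
Local Notation C := R[i].
Variables (H : completeNormedModType C) (dot : {dot H for Num.conj}) (m : nat).
Hypothesis ip : inner_product dot.
Variables (D0 : set 'rV[C]_m) (g : 'rV[C]_m -> H).
Hypothesis oD : open D0.
Hypothesis dg : forall z, D0 z -> differentiable g z.
Hypothesis gn0 : forall z, D0 z -> g z != 0.

Lemma path_near (w v : 'rV[C]_m) : D0 w -> exists2 e : R, 0 < e &
  forall t : R, `|t| < e -> D0 (w + t%:C *: v).
Proof.
move=> Dw; have [d d0 hd] := (nbhs_nrmP w D0).1 (open_nbhs_nbhs (conj oD Dw)).
have v0 : 0 < nrm v + 1 by rewrite ltr_wpDl ?nrm_ge0.
exists (d / (nrm v + 1)); first by rewrite divr_gt0.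
move=> t; rewrite ltr_pdivlMr // => ht; apply: hd.
rewrite addrC addKr nrmZ nrmR; apply: le_lt_trans ht.
by apply: ler_wpM2l; rewrite ?lerDl.
Qed.

Lemma sqnorm_neq0 z : D0 z -> sqnorm dot g z != 0.
Proof.
move=> Dz; rewrite sqnormE // -(rmorph0 (real_complex R)) (inj_eq (@complexI R)).
by rewrite expf_neq0 // gt_eqF // nrm_gt0 // gn0.
Qed.

(** The product and quotient rules along the real line of direction [a] times
    the i-th basis vector.  The inner product is antilinear in its second
    argument, whence the conjugate factor of the second derivative [B]. *)
Lemma real_derive_dzbar_log (w : 'rV[C]_m) (i j : 'I_m) (B : H) (a : C) : a != 0 -> D0 w ->
  (fun t : C => t^-1 *: ('d g (w + t *: 'e_i) 'e_j - 'd g w 'e_j)) @ (0 : C)^' --> B ->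
  real_derive (dzbar j (log_sqnorm g)) (a *: 'e_i) w =
  ((a * dot ('d g w 'e_i) ('d g w 'e_j) + Num.conj a * dot (g w) B) * sqnorm dot g w
    - dot (g w) ('d g w 'e_j) * (2 * complex.Re (a * dot ('d g w 'e_i) (g w)))%:C)
  / sqnorm dot g w ^+ 2.
Proof.
move=> a0 Dw hB; have [e e0 he] := path_near (a *: 'e_i) Dw.
apply: rderiv_real_derive.
apply: (@rderiv_near _ _ (fun t : R => dot (g (w + t%:C *: (a *: 'e_i)))
   ('d g (w + t%:C *: (a *: 'e_i)) 'e_j) / sqnorm dot g (w + t%:C *: (a *: 'e_i))) _ _ e e0).
  by move=> t ht; rewrite (dzbar_log ip dg gn0) //; exact: he.
have r1 := @rderiv_path _ _ _ g w 'e_i a (dg Dw).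
have r2 := @rderiv_complex _ _ _ (fun z => 'd g z 'e_j) w 'e_i a B a0 hB.
have r3 := rderiv_dot ip r1 r2.
have r4 := @rderiv_sqnorm _ _ dot m ip D0 g dg w 'e_i a Dw.
have N0 : sqnorm dot g (w + (0 : R)%:C *: (a *: 'e_i)) != 0.
  by rewrite scale0r addr0; exact: sqnorm_neq0.
have h := rderiv_quot N0 r3 r4; cbv beta in h.
rewrite scale0r addr0 dotZl dotZr in h; exact: h.
Qed.

(** Combining the derivatives in the directions 1 and i keeps the terms that are
    linear in the direction and cancels the antilinear ones. *)
Lemma wirtinger_algebra (I P Q N G X Y Z : C) : N != 0 -> I * I = -1 ->
  X - I * Y = 2 * Z ->
  (((P + Q) * N - G * X) / N ^+ 2
    - I * (((I * P + - I * Q) * N - G * Y) / N ^+ 2)) / 2 =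
  (P * N - G * Z) / N ^+ 2.
Proof.
move=> N0 ii XYZ; have XE : X = 2 * Z + I * Y by rewrite -XYZ subrK.
have -> : I * (((I * P + - I * Q) * N - G * Y) / N ^+ 2) =
   (((I * I) * P - (I * I) * Q) * N - I * G * Y) / N ^+ 2 by field.
by rewrite ii XE; field.
Qed.

Lemma dz_dzbar_log (w : 'rV[C]_m) (i j : 'I_m) : D0 w ->
  dz i (dzbar j (log_sqnorm g)) w =
  (dot ('d g w 'e_i) ('d g w 'e_j) * sqnorm dot g w
   - dot (g w) ('d g w 'e_j) * dot ('d g w 'e_i) (g w)) / sqnorm dot g w ^+ 2.
Proof.
move=> Dw; have [B hB] := second_derivative ip 'e_j 'e_i oD Dw dg.
rewrite /dz -[X in real_derive _ X _ - _]scale1r.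
have i0 : ('i : C) != 0.
  by rewrite eq_complex /= oner_eq0 andbF.
rewrite !(real_derive_dzbar_log _ _ hB) ?oner_eq0 //.
rewrite rmorph1 !mul1r; have N0 := sqnorm_neq0 Dw.
have -> : Num.conj ('i : C) = - 'i.
  by apply/eqP; rewrite eq_complex /= oppr0 !eqxx.
have ii : ('i : C) * 'i = -1 by rewrite -expr2 sqr_i.
have key (b : C) : (2 * complex.Re b)%:C - 'i * (2 * complex.Re ('i * b))%:C = 2 * b.
  by case: b => p q; apply/eqP; rewrite eq_complex /=; apply/andP; split; apply/eqP; ring.
exact: wirtinger_algebra N0 ii (key (dot ('d g w 'e_i) (g w))).
Qed.

Lemma section_curvatureE (w : 'rV[C]_m) (i j : 'I_m) : D0 w ->
  section_curvature g w i j =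
  (dot (g w) ('d g w 'e_j) * dot ('d g w 'e_i) (g w)
   - dot ('d g w 'e_i) ('d g w 'e_j) * dot (g w) (g w)) / dot (g w) (g w) ^+ 2.
Proof. by move=> Dw; rewrite mxE dz_dzbar_log // -mulNr opprB. Qed.

Lemma section_curvature_hermitian w : D0 w -> section_curvature g w \is hermsymmx.
Proof.
move=> Dw; have := fun i j => section_curvatureE i j Dw.
move: (section_curvature g w) => K hK; apply/is_hermitianmxP; apply/matrixP => i j.
rewrite expr0 scale1r !mxE !hK !expr2.
rewrite fmorph_div rmorphB !rmorphM /= -!(dotC dot).
by congr ((_ - _) / _); rewrite mulrC.
Qed.

(** The double sum over the entries collapses by sesquilinearity, with the
    derivative of [g] in the direction [v] in place of u. *)
Lemma quadratic_form w (v : 'rV[C]_m) : D0 w ->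
  (v *m section_curvature g w *m v ^t Num.conj) 0 0 =
  ((nrm (dot ('d g w v) (g w)) ^+ 2 - nrm ('d g w v) ^+ 2 * nrm (g w) ^+ 2)
    / nrm (g w) ^+ 4)%:C.
Proof.
move=> Dw; set u := 'd g w v; set G := g w.
have uE : u = \sum_i v 0 i *: 'd g w 'e_i.
  rewrite /u {1}[v]row_sum_delta linear_sum; apply: eq_bigr => i _.
  by rewrite linearZ.
have e1 : dot u G = \sum_i v 0 i * dot ('d g w 'e_i) G.
  by rewrite uE dot_suml; apply: eq_bigr => i _; rewrite dotZl.
have e2 : dot G u = \sum_j Num.conj (v 0 j) * dot G ('d g w 'e_j).
  by rewrite uE dot_sumr; apply: eq_bigr => i _; rewrite dotZr.
have e3 : dot u u = \sum_j \sum_i v 0 i * Num.conj (v 0 j) * dot ('d g w 'e_i) ('d g w 'e_j).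
  rewrite {2}uE dot_sumr; apply: eq_bigr => j _; rewrite dotZr uE dot_suml mulr_sumr.
  by apply: eq_bigr => i _; rewrite dotZl mulrCA mulrA.
transitivity ((dot G u * dot u G - dot u u * dot G G) / dot G G ^+ 2).
  have := fun i j => section_curvatureE i j Dw; rewrite -/G.
  move: (section_curvature g w) (dot G G) => K n hK.
  rewrite e1 e2 e3 !mulr_suml -sumrB mulr_suml mxE; apply: eq_bigr => j _.
  rewrite !mxE mulr_sumr !mulr_suml -sumrB mulr_suml; apply: eq_bigr => i _.
  by rewrite hK; ring.
have -> : dot G u * dot u G = (nrm (dot u G) ^+ 2)%:C.
  by rewrite (dotC dot G) mulrC -normCK nrmE rmorphXn.
rewrite !(dotxx ip) -rmorphM -rmorphB -rmorphXn -fmorph_div.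
by rewrite -exprM.
Qed.

Lemma negative_definite_of w : D0 w ->
  (forall v, v != 0 -> forall a, 'd g w v != a *: g w) ->
  negative_definite (section_curvature g w).
Proof.
move=> Dw hv; split; first exact: section_curvature_hermitian.
move=> v v0; rewrite quadratic_form //.
have gp : 0 < nrm (g w) by rewrite nrm_gt0 // gn0.
rewrite -(rmorph0 (real_complex R)) ltcR pmulr_llt0 ?invr_gt0 ?exprn_gt0 //.
by rewrite subr_lt0; apply: (cauchy_schwarz_lt ip); [exact: gn0|exact: hv].
Qed.

End Curv2.

(** * A bound from below for tuples with closed range *)

Section BoundedBelow.
Context {R : realType}.
Local Notation C := R[i].
Variables (H : completeNormedModType C) (dot : {dot H for Num.conj}) (m : nat).
Hypothesis ip : inner_product dot.

Lemma cauchy_seq (u : nat -> H) :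
  (forall e : R, 0 < e -> exists n, forall k, (n <= k)%N -> nrm (u k - u n) < e) ->
  exists l, forall e : R, 0 < e -> exists n, forall k, (n <= k)%N -> nrm (u k - l) < e.
Proof.
move=> hu; have [|l hl] := @complete_cvg _ H (u @ \oo) _.
  by move=> e /hu [n hn]; exists (u n); exists n.
exists l => e e0; have /cvg_nrmP /(_ e e0) [n _ hn] := hl.
by exists n => k; exact: hn.
Qed.

(** A family that is approximated by the image of [A] in each component is
    approximated in the product topology. *)
Lemma closed_range_approx (A : H -> 'rV[H]_m) (y : 'I_m -> H) :
  closed (range A) ->
  (forall e : R, 0 < e -> exists x, forall i, nrm (A x 0 i - y i) < e) ->
  exists x, forall i, A x 0 i = y i.
Proof.
move=> cA hy; have [x _ hx] : range A (\row_i y i).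
  apply: cA => B /nbhs_ballP [e /= e0 sub].
  have := gtr0_real e0 => /complex_realP [r er]; subst e.
  rewrite ltcR in e0; have [x hx] := hy r e0.
  exists (A x); split; first by exists x.
  apply: sub; split=> [|i j]; first by rewrite ltcR.
  rewrite mxE -ball_normE /= distrC nrmE ltcR.
  by rewrite (ord1 i).
by exists x => i; rewrite hx mxE.
Qed.

Variables (A : 'I_m -> {linear H -> H}) (K : R) (e e1 : H).
Hypothesis K0 : 0 <= K.
Hypothesis AK : forall i x, nrm (A i x) <= K * nrm x.
Hypothesis A_closed : forall y : 'I_m -> H,
  (forall d : R, 0 < d -> exists x, forall i, nrm (A i x - y i) < d) ->
  exists x, forall i, A i x = y i.
Hypothesis Ae1 : forall i, A i e1 = 0.
Hypothesis e1e : dot e1 e != 0.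
Hypothesis Aker : forall x, (forall i, A i x = 0) -> dot x e = 0 -> x = 0.

(** The seminorm of the image; on the complement [M] of the kernel it is a norm. *)
Let N (x : H) : R := \sum_i nrm (A i x).
(** The orthogonal complement of [e], a complement of the kernel of the tuple. *)
Let M (x : H) : Prop := dot x e = 0.

Let N_ge0 x : 0 <= N x. Proof. by apply: sumr_ge0 => i _; exact: nrm_ge0. Qed.
Let N0 : N 0 = 0.
Proof. by rewrite /N big1 // => i _; rewrite linear0 nrm0. Qed.
Let ND x y : N (x + y) <= N x + N y.
Proof. by rewrite /N -big_split /=; apply: ler_sum => i _; rewrite linearD nrmD. Qed.
Let NN x : N (- x) = N x.
Proof. by apply: eq_bigr => i _; rewrite linearN nrmN. Qed.
Let NB x y : N (x - y) <= N x + N y.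
Proof. by rewrite -(NN y) ND. Qed.
Let NBC x y : N (x - y) = N (y - x).
Proof. by rewrite -NN opprB. Qed.
Let NZ a x : N (a *: x) = nrm a * N x.
Proof. by rewrite /N mulr_sumr; apply: eq_bigr => i _; rewrite linearZ nrmZ. Qed.
Let N_nrm x : N x <= m%:R * K * nrm x.
Proof.
rewrite /N (le_trans (ler_sum _ (fun i _ => AK i x))) //.
by rewrite sumr_const card_ord -[leRHS]mulrA mulr_natl.
Qed.
Let N_tri x y z : N (x - z) <= N (x - y) + N (y - z).
Proof. by rewrite (le_trans _ (ND _ _)) // addrA subrK. Qed.
Let A_N i x : nrm (A i x) <= N x.
Proof. by rewrite /N (bigD1 i) //= lerDl; apply: sumr_ge0 => j _; exact: nrm_ge0. Qed.
Let N_eq0 x : M x -> N x = 0 -> x = 0.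
Proof.
move=> Mx Nx; apply: Aker Mx => i; apply: nrm_eq0.
by apply/eqP; rewrite eq_le nrm_ge0 andbT -Nx A_N.
Qed.
Let M0 : M 0. Proof. exact: dot0l. Qed.
Let MB x y : M x -> M y -> M (x - y).
Proof. by rewrite /M dotBl => -> ->; rewrite subrr. Qed.
Let MD x y : M x -> M y -> M (x + y).
Proof. by rewrite /M dotDl => -> ->; rewrite addr0. Qed.
Let MZ a x : M x -> M (a *: x).
Proof. by rewrite /M dotZl => ->; rewrite mulr0. Qed.

(** A preimage can be moved into the orthogonal complement of [e] along [e1]. *)
Lemma complement_preimage (y : 'I_m -> H) :
  (forall d : R, 0 < d -> exists x, forall i, nrm (A i x - y i) < d) ->
  exists2 x, dot x e = 0 & forall i, A i x = y i.
Proof.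
move=> /A_closed [x hx]; exists (x - (dot x e / dot e1 e) *: e1).
  by rewrite dotBl dotZl divfK // subrr.
by move=> i; rewrite linearB linearZ /= Ae1 scaler0 subr0.
Qed.

(** Since the range is closed, [M] is complete for the norm [N]. *)
Let N_complete (u : nat -> H) :
  (forall d : R, 0 < d -> exists n, forall k, (n <= k)%N -> N (u k - u n) < d) ->
  exists2 x, M x & forall d : R, 0 < d -> exists n, forall k, (n <= k)%N -> N (u k - x) < d.
Proof.
move=> hu; have hy i : exists l, forall d : R, 0 < d ->
    exists n, forall k, (n <= k)%N -> nrm (A i (u k) - l) < d.
  apply: cauchy_seq => d /hu [n hn]; exists n => k /hn; apply: le_lt_trans.
  by rewrite -linearB; exact: A_N.
have [y {}hy] := choice hy.
have unif d : 0 < d -> exists n, forall k, (n <= k)%N -> forall i, nrm (A i (u k) - y i) < d.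
  move=> d0; have [f hf] := choice (fun i => hy i d d0).
  exists (\max_i f i)%N => k hk i; apply: hf.
  by apply: leq_trans hk; exact: leq_bigmax.
have [|x Mx hx] := complement_preimage (y := y).
  by move=> d /unif [n hn]; exists (u n); exact: hn (leqnn n).
exists x => // d d0; have m0 : 0 < (m%:R + 1 : R) by rewrite ltr_wpDl.
have [n hn] := unif _ (divr_gt0 d0 m0); exists n => k /hn hk.
apply: (@le_lt_trans _ _ (\sum_(i < m) (d / (m%:R + 1)))).
  by apply: ler_sum => i _; rewrite linearB hx; exact: ltW (hk i).
rewrite sumr_const card_ord -[X in X < _]mulr_natl.
by rewrite mulrCA gtr_pMr // ltr_pdivrMr // mul1r ltrDl.
Qed.

(** Baire's theorem for ([M], [N]), covered by the closures of the balls of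
    integer radius of H: one of them contains a ball.  Otherwise there is a nested
    sequence of [N]-balls, each of which avoids all vectors of norm at most its
    index, and the norm of their common point would exceed every integer. *)
Let baire : exists (k : nat) (x0 : H) (r : R), [/\ M x0, 0 < r &
  forall x, M x -> N (x - x0) <= r -> forall d, 0 < d ->
  exists y, [/\ M y, nrm y <= k%:R & N (x - y) < d]].
Proof.
apply: contrapT => nH.
have step (p : nat * (H * R)) : exists q : H * R, M p.2.1 -> 0 < p.2.2 ->
    [/\ M q.1, 0 < q.2, q.2 <= p.2.2 / 2, N (q.1 - p.2.1) <= p.2.2 / 2 &
      forall y, M y -> nrm y <= p.1%:R -> q.2 < N (q.1 - y)].
  case: p => k [x0 r] /=.
  have [Mx0|] := pselect (M x0); last by move=> h; exists (x0, r) => /h.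
  have [r0|] := pselect (0 < r); last by move=> h; exists (x0, r) => _ /h.
  have [x [Mx Nx [d d0 hd]]] : exists x, [/\ M x, N (x - x0) <= r / 2 &
      exists2 d, 0 < d & forall y, M y -> nrm y <= k%:R -> d <= N (x - y)].
    apply: contrapT => nx; apply: nH; exists k, x0, (r / 2).
    split=> //; first by rewrite divr_gt0.
    move=> x Mx Nx d d0; apply: contrapT => ny; apply: nx; exists x; split=> //.
    exists d => // y My hy; rewrite leNgt; apply/negP => h; apply: ny.
    by exists y.
  exists (x, Num.min (d / 2) (r / 2)) => _ _ /=; split=> //.
  - by rewrite lt_min !divr_gt0.
  - by rewrite ge_min lexx orbT.
  - move=> y My hy; rewrite gt_min; apply/orP; left.
    by apply: lt_le_trans (hd y My hy); lra.
have [F hF] := choice step.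
(* The centres and radii of the nested balls. *)
pose s := fix s n : H * R := if n is n'.+1 then F (n', s n') else (0, 1).
have sS n : s n.+1 = F (n, s n) by [].
have inv n : M (s n).1 /\ 0 < (s n).2.
  elim: n => [|n [h1 h2]]; first by split; [exact: M0|exact: ltr01].
  by rewrite sS; have [] := hF (n, s n) h1 h2.
have st n : [/\ (s n.+1).2 <= (s n).2 / 2, N ((s n.+1).1 - (s n).1) <= (s n).2 / 2 &
    forall y, M y -> nrm y <= n%:R -> (s n.+1).2 < N ((s n.+1).1 - y)].
  by rewrite sS; have [h1 h2] := inv n; have [] := hF (n, s n) h1 h2.
have near n j : N ((s (n + j)%N).1 - (s n).1) + (s (n + j)%N).2 <= (s n).2.
  elim: j => [|j IH]; first by rewrite addn0 subrr N0 add0r.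
  have [h1 h2 _] := st (n + j)%N; rewrite addnS.
  have := N_tri (s (n + j).+1).1 (s (n + j)%N).1 (s n).1; lra.
have [S [S0 Sp SS Sd]] := halving (@ltr01 R).
have rS n : (s n).2 <= S n.
  elim: n => [|n IH]; first by rewrite S0.
  by have [h1 _ _] := st n; have := SS n; lra.
have [x Mx hx] : exists2 x, M x & forall d : R, 0 < d ->
    exists n, forall k, (n <= k)%N -> N ((s k).1 - x) < d.
  apply: (N_complete (u := fun n => (s n).1)) => d /Sd [n hn]; exists n => k nk.
  have := near n (k - n)%N; rewrite subnKC // => h.
  have [_ p] := inv k; have := rS n; lra.
have [k hk] : exists k : nat, nrm x <= k%:R.
  by exists (Num.truncn (nrm x)).+1; rewrite ltW // truncnS_gt.
(* The k-th step excludes all vectors of norm at most k from the next ball. *)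
have [_ _ /(_ x Mx hk) lt1] := st k.
pose d := N ((s k.+1).1 - x) - (s k.+1).2.
have d0 : 0 < d by rewrite subr_gt0.
have [n hn] := hx d d0.
have h1 := near k.+1 n; have h2 := hn (k.+1 + n)%N (leq_addl _ _).
have h3 := N_tri (s k.+1).1 (s (k.+1 + n)%N).1 x.
have [_ p] := inv (k.+1 + n)%N; rewrite NBC in h1; rewrite /d in h2; lra.
Qed.

(** By symmetry and scaling, the ball given by [baire] may be centred at 0. *)
Let approx : exists2 c : R, 0 <= c & forall x, M x -> forall d, 0 < d ->
  exists y, [/\ M y, nrm y <= c * N x & N (x - y) < d].
Proof.
have [k [x0 [r [Mx0 r0 hk]]]] := baire.
have small x : M x -> N x <= r -> forall d, 0 < d ->
    exists y, [/\ M y, nrm y <= 2 * k%:R & N (x - y) < d].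
  move=> Mx Nx d d0; have d2 : 0 < d / 2 by rewrite divr_gt0.
  have [|y1 [My1 ny1 Ny1]] := hk (x + x0) (MD Mx Mx0) _ _ d2; first by rewrite addrK.
  have [|y2 [My2 ny2 Ny2]] := hk x0 Mx0 _ _ d2; first by rewrite subrr N0 ltW.
  exists (y1 - y2); split; first exact: MB.
    by rewrite (le_trans (nrmB _ _)) // mulr2n mulrDl mul1r lerD.
  have -> : x - (y1 - y2) = (x + x0 - y1) - (x0 - y2).
    by rewrite subrACA addrK.
  by rewrite (le_lt_trans (NB _ _)) // [d]splitr ltrD.
exists (2 * k%:R / r) => [|x Mx d d0]; first by rewrite divr_ge0 ?mulr_ge0 ?ler0n ?(ltW r0).
have [Nx0|Nx0] := eqVneq (N x) 0.
  by exists 0; rewrite nrm0 Nx0 mulr0 subr0 Nx0.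
have Np : 0 < N x by rewrite lt_neqAle eq_sym Nx0 N_ge0.
pose a : C := (r / N x)%:C.
have ap : 0 < r / N x by rewrite divr_gt0.
have na : nrm a = r / N x by rewrite nrmR gtr0_norm.
have a0 : a != 0 by apply: contraTneq ap => h; rewrite -na h nrm0 ltxx.
have [||y [My ny Ny]] := small (a *: x) (MZ _ Mx) _ (d * nrm a).
- by rewrite NZ na divfK.
- by rewrite mulr_gt0 // na.
exists (a^-1 *: y); split; first exact: MZ.
  rewrite nrmZ nrmV na invf_div.
  have -> : 2 * k%:R / r * N x = N x / r * (2 * k%:R) by ring.
  by rewrite ler_wpM2l // divr_ge0 ?N_ge0 // ltW.
have -> : x - a^-1 *: y = a^-1 *: (a *: x - y) by rewrite scalerBr scalerA mulVf // scale1r.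
by rewrite NZ nrmV mulrC ltr_pdivrMr // na.
Qed.

(** The open mapping argument: corrections taken from [approx] whose images are
    halved at each step sum to [x] itself, with norms bounded by a geometric
    series. *)
Lemma bounded_below : exists2 c : R, 0 <= c &
  forall x, dot x e = 0 -> nrm x <= c * \sum_i nrm (A i x).
Proof.
have [c c0 hc] := approx; exists (2 * c); first by rewrite mulr_ge0.
move=> x Mx; rewrite -/(N x).
have [Nx0|Nx0] := eqVneq (N x) 0; first by rewrite (N_eq0 Mx Nx0) nrm0 N0 mulr0.
have Np : 0 < N x by rewrite lt_neqAle eq_sym Nx0 N_ge0.
have [S [S0 Sp SS Sd]] := halving Np.
have step (p : nat * H) : exists y, M p.2 -> N p.2 <= S p.1 ->
    [/\ M y, nrm y <= c * S p.1 & N (p.2 - y) <= S p.1.+1].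
  have [Mp|] := pselect (M p.2); last by move=> h; exists 0 => /h.
  have [y [My ny Ny]] := hc p.2 Mp (S p.1.+1) (Sp _).
  exists y => _ hp; split=> //; last exact: ltW.
  by apply: (le_trans ny); apply: ler_wpM2l.
have [F hF] := choice step.
(* What remains of [x] after n corrections. *)
pose z := fix z n := if n is n'.+1 then z n' - F (n', z n') else x.
have zS n : z n.+1 = z n - F (n, z n) by [].
have inv n : M (z n) /\ N (z n) <= S n.
  elim: n => [|n [h1 h2]]; first by rewrite /= S0.
  by rewrite zS; have [h3 h4 h5] := hF (n, z n) h1 h2; split; [exact: MB|].
have dz n j : nrm (z n - z (n + j)%N) <= 2 * c * (S n - S (n + j)%N).
  elim: j => [|j IH]; first by rewrite addn0 !subrr nrm0 mulr0.
  have [h1 h2] := inv (n + j)%N; have [_ h3 _] := hF (n + j, z (n + j))%N h1 h2.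
  rewrite addnS (le_trans (nrm_sub _ (z (n + j)%N) _)) //.
  have -> : 2 * c * (S n - S (n + j).+1) =
    2 * c * (S n - S (n + j)%N) + c * S (n + j)%N by rewrite (SS (n + j)%N); ring.
  apply: lerD => //.
  by rewrite zS opprB addrC subrK.
have [l hl] : exists l, forall d : R, 0 < d ->
    exists n, forall k, (n <= k)%N -> nrm (z k - l) < d.
  apply: cauchy_seq => d d0.
  have c1 : 0 < 2 * c + 1 by rewrite ltr_wpDl ?mulr_ge0.
  have [n hn] := Sd _ (divr_gt0 d0 c1); exists n => k nk.
  rewrite nrmBC; have := dz n (k - n)%N; rewrite subnKC // => h.
  apply: (le_lt_trans h); rewrite ltr_pdivlMr // in hn.
  have := Sp k; have := Sp n; nra.
have Nl : N l = 0.
  apply/eqP; rewrite eq_le N_ge0 andbT; apply/ler_addgt0Pl => d d0; rewrite addr0.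
  have d2 : 0 < d / 2 by rewrite divr_gt0.
  have K1 : 0 < m%:R * K + 1 by rewrite ltr_wpDl ?mulr_ge0.
  have [n1 h1] := Sd _ d2; have [n2 h2] := hl _ (divr_gt0 d2 K1).
  have Smono j : S (n1 + j)%N <= S n1.
    elim: j => [|j IH]; first by rewrite addn0.
    by rewrite addnS; have := SS (n1 + j)%N; have := Sp (n1 + j).+1; lra.
  have := h2 (n1 + n2)%N (leq_addl _ _); rewrite ltr_pdivlMr // => h3.
  have [_ h4] := inv (n1 + n2)%N.
  have h5 := N_nrm (z (n1 + n2)%N - l).
  have h6 := N_tri l (z (n1 + n2)%N) 0; rewrite !subr0 NBC in h6.
  have h7 := Smono n2; have h8 := nrm_ge0 (z (n1 + n2)%N - l).
  nra.
have Ml : M l.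
  apply: nrm_eq0; apply/eqP; rewrite eq_le nrm_ge0 andbT.
  apply/ler_addgt0Pl => d d0; rewrite addr0.
  have K1 : 0 < nrm e + 1 by rewrite ltr_wpDl ?nrm_ge0.
  have [n h2] := hl _ (divr_gt0 d0 K1); have := h2 n (leqnn n).
  rewrite ltr_pdivlMr // => h3; have [h4 _] := inv n.
  have -> : dot l e = - dot (z n - l) e by rewrite dotBl h4 sub0r opprK.
  rewrite nrmN (le_trans (cauchy_schwarz ip _ _)) // (le_trans _ (ltW h3)) //.
  by rewrite ler_wpM2l ?nrm_ge0 // lerDl.
have l0 := N_eq0 Ml Nl.
apply/ler_addgt0Pr => d d0; have [n hn] := hl d d0.
have := hn n (leqnn n); rewrite l0 subr0 => h1.
have := dz 0%N n; rewrite add0n S0 /= => h2.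
have := nrmD (x - z n) (z n); rewrite subrK => h3.
have := Sp n; nra.
Qed.

End BoundedBelow.

(** * Row vectors and linear combinations *)

Section Rows.
Context {R : realType}.
Local Notation C := R[i].
Variable m : nat.

(** The norm of row vectors is the maximum of the moduli of the entries. *)
Lemma nrm_coord (x : 'rV[C]_m) i : nrm (x 0 i) <= nrm x.
Proof.
apply/ler_addgt0Pr => d d0.
have e0 : 0 < nrm x + d by rewrite ltr_wpDl ?nrm_ge0.
have : ball (0 : 'rV[C]_m) (nrm x + d)%:C x.
  by rewrite -ball_normE /= sub0r normrN nrmE ltcR ltrDl.
move=> [_ /(_ 0 i)]; rewrite -ball_normE /= mxE sub0r normrN nrmE ltcR.
exact: ltW.
Qed.

Lemma nrm_le_sum (x : 'rV[C]_m) : nrm x <= \sum_i nrm (x 0 i).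
Proof.
have [x0|x0] := eqVneq (mx_norm x) 0.
  have -> : nrm x = 0 by rewrite /nrm -[`|x|]/(mx_norm x) x0.
  by apply: sumr_ge0 => i _; exact: nrm_ge0.
have [[i j] /= hx] := mx_norm_neq0 x0.
have -> : nrm x = nrm (x i j) by rewrite /nrm -[`|x|]/(mx_norm x) hx.
by rewrite (ord1 i) (bigD1 j) //= lerDl; apply: sumr_ge0 => k _; exact: nrm_ge0.
Qed.

Lemma sum_nrm_le (x : 'rV[C]_m) : \sum_i nrm (x 0 i) <= m%:R * nrm x.
Proof.
rewrite (le_trans (ler_sum _ (fun i _ => nrm_coord x i))) //.
by rewrite sumr_const card_ord mulr_natl.
Qed.

Lemma conj_set_open (D : set 'rV[C]_m) : open D -> open (conj_set D).
Proof.
move=> oD; rewrite openE => z [u Du <-{z}].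
have [d d0 hd] := (nbhs_nrmP u D).1 (open_nbhs_nbhs (conj oD Du)).
have m0 : 0 < (m%:R + 1 : R) by rewrite ltr_wpDl.
apply/nbhs_nrmP; exists (d / (m%:R + 1)); first by rewrite divr_gt0.
move=> y; rewrite ltr_pdivlMr // => hy; exists (map_mx Num.conj y); last first.
  by apply/matrixP => i j; rewrite !mxE conjCK.
apply: hd; apply: (le_lt_trans (nrm_le_sum _)); apply: le_lt_trans hy.
apply: (@le_trans _ _ (m%:R * nrm (y - map_mx Num.conj u))); last first.
  by rewrite mulrC ler_wpM2l ?nrm_ge0 // lerDl.
apply: le_trans (sum_nrm_le _); apply: ler_sum => i _.
rewrite !mxE -[X in _ <= X]nrmJ rmorphB /=; by rewrite conjCK.
Qed.

Variable H : normedModType C.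

Definition lincomb (d : 'I_m -> H) (v : 'rV[C]_m) : H := \sum_j v 0 j *: d j.

Lemma lincomb_linear d : linear (lincomb d).
Proof.
move=> a u v; rewrite /lincomb scaler_sumr -big_split /=; apply: eq_bigr => j _.
by rewrite !mxE scalerDl scalerA.
Qed.

HB.instance Definition _ d :=
  GRing.isLinear.Build C 'rV[C]_m H _ (lincomb d) (lincomb_linear d).

Lemma lincomb_continuous d : continuous (lincomb d).
Proof.
move=> x; apply/continuous_epsP => e e0; pose k := \sum_j nrm (d j).
have k0 : 0 <= k by apply: sumr_ge0 => j _; exact: nrm_ge0.
have k1 : 0 < k + 1 by rewrite ltr_wpDl.
exists (e / (k + 1)); first by rewrite divr_gt0.
move=> y; rewrite ltr_pdivlMr // => hy; rewrite -linearB.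
apply: le_lt_trans hy; apply: (@le_trans _ _ (nrm (y - x) * k)); last first.
  by rewrite ler_wpM2l ?nrm_ge0 // lerDl.
apply: (le_trans (nrm_sum _ _ _)); rewrite mulr_sumr; apply: ler_sum => j _.
by rewrite nrmZ; apply: ler_wpM2r; rewrite ?nrm_ge0 ?nrm_coord.
Qed.

End Rows.

(** * Joint eigenvectors of a tuple *)

Section Tuples.
Context {R : realType}.
Local Notation C := R[i].
Variables (m : nat) (H : normedModType C).

Lemma kerDP (T : 'I_m -> {linear H -> H}) (w : 'rV[C]_m) x :
  kerD T w x <-> forall i, T i x = w 0 i *: x.
Proof.
split=> [hx i|hx].
  have /rowP /(_ i) := hx; rewrite !mxE => /eqP.
  by rewrite subr_eq0 => /eqP.
by apply/rowP => i; rewrite !mxE hx subrr.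
Qed.

Lemma bounded_nrm (T : {linear H -> H}) : bounded_operator T ->
  exists2 k : R, 0 <= k & forall x, nrm (T x) <= k * nrm x.
Proof.
move=> [M hM]; exists (nrm M); first exact: nrm_ge0.
move=> x; rewrite -lecR rmorphM /= -!nrmE.
have := hM x => h; rewrite (le_trans h) //.
have g0 : 0 <= M * `|x| by rewrite (le_trans _ h).
by rewrite -[leLHS]ger0_norm // normrM normr_id.
Qed.

Lemma bounded_cvg (T : {linear H -> H}) (X : Type) (F : set_system X)
    (FF : Filter F) (f : X -> H) (l : H) :
  bounded_operator T -> f @ F --> l -> T (f x) @[x --> F] --> T l.
Proof.
move=> /bounded_nrm [k k0 hk] /cvg_nrmP hf; apply/cvg_nrmP => e e0.
have k1 : 0 < k + 1 by rewrite ltr_wpDl.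
have := hf _ (divr_gt0 e0 k1); apply: filterS => x; rewrite ltr_pdivlMr // => h.
rewrite -linearB (le_lt_trans (hk _)) // (le_lt_trans _ h) //.
by rewrite mulrC ler_wpM2l ?nrm_ge0 // lerDl.
Qed.

(** The eigenvalue equation along the real line of direction [v] is
    differentiated at 0. *)
Lemma derivative_eigen (T : 'I_m -> {linear H -> H}) (D0 : set 'rV[C]_m)
    (g : 'rV[C]_m -> H) (w v : 'rV[C]_m) (i : 'I_m) :
  bounded_operator (T i) -> open D0 -> D0 w -> differentiable g w ->
  (forall z, D0 z -> kerD T z (g z)) ->
  T i ('d g w v) = w 0 i *: 'd g w v + v 0 i *: g w.
Proof.
move=> bT oD Dw dg hker.
have r1 := @rderiv_path _ _ _ g w v 1 dg; rewrite !scale1r in r1.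
have [e e0 he] := path_near oD v Dw.
pose c (t : R) := g (w + t%:C *: v).
have c0 : c 0 = g w by rewrite /c scale0r addr0.
have {}r1 : rderiv c ('d g w v).
  exact: r1.
have l1 := bounded_cvg _ bT r1.
have cc := rderiv_cont r1; rewrite c0 in cc.
have l2 : (fun t : R => w 0 i *: ((t^-1)%:C *: (c t - c 0)) + v 0 i *: c t) @ (0 : R)^'
    --> w 0 i *: 'd g w v + v 0 i *: g w.
  by apply: cvgD; apply: cvgZ => //; exact: cvg_cst.
have l3 : (fun t : R => T i ((t^-1)%:C *: (c t - c 0))) @ (0 : R)^'
    --> w 0 i *: 'd g w v + v 0 i *: g w.
  apply: cvg_trans l2; apply: near_eq_cvg; apply/dnbhsRP; exists e => // t t0.
  rewrite subr0 => te.
  have -> : T i ((t^-1)%:C *: (c t - c 0)) = (t^-1)%:C *: (T i (c t) - T i (c 0)).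
    by rewrite linearZ /= linearB.
  have hc : T i (c t) = (w + t%:C *: v) 0 i *: c t.
    exact: ((kerDP _ _ _).1 (hker _ (he t te)) i).
  rewrite hc c0 ((kerDP _ _ _).1 (hker _ Dw) i).
  have tC : t%:C != 0 :> C by rewrite -(rmorph0 (real_complex R)) (inj_eq (@complexI R)).
  rewrite !mxE scalerDl [X in _ = _ *: X]addrAC -[X in _ = _ *: (X + _)]scalerBr [RHS]scalerDr; congr (_ + _).
    by rewrite !scalerA mulrC.
  by rewrite scalerA mulrA fmorphV mulVf // mul1r.
have l1b := l1 (dnbhs_filter _).
exact: (@norm_cvg_unique _ H _ _ _ _ l1b l3).
Qed.

End Tuples.

(** * Holomorphic sections of the bundle of joint eigenvectors *)

Section Existence.
Context {R : realType}.
Local Notation C := R[i].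
Variables (m : nat) (H : completeNormedModType C) (dot : {dot H for Num.conj}).
Hypothesis ip : inner_product dot.
Variables (T : 'I_m -> {linear H -> H}) (D : set 'rV[C]_m).
Hypothesis oD : open D.
Hypothesis cd : cowen_douglas1 D T.
Variable e : H.

(** The set on which the eigenvector can be normalised by its product with [e]. *)
Let good : set 'rV[C]_m := [set z | D z /\ exists2 x, kerD T z x & dot x e != 0].
Let g (z : 'rV[C]_m) : H := xget 0 [set x | kerD T z x /\ dot x e = 1].

Let kerZ z a x : kerD T z x -> kerD T z (a *: x).
Proof.
move=> /kerDP hx; apply/kerDP => i; rewrite linearZ /= hx !scalerA.
by rewrite mulrC.
Qed.

Let gP z : good z -> kerD T z (g z) /\ dot (g z) e = 1.
Proof.
move=> [_ [x kx xe]]; apply: (@xgetPex _ 0 [set x | kerD T z x /\ dot x e = 1]).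
by exists ((dot x e)^-1 *: x); split; [exact: kerZ|rewrite dotZl mulVf].
Qed.

Let A (z : 'rV[C]_m) (i : 'I_m) : {linear H -> H} := (T i \- z 0 i \*: idfun)%R.

Let AE z i x : A z i x = T i x - z 0 i *: x. Proof. by []. Qed.

Let AZ z i a x : A z i (a *: x) = a *: A z i x.
Proof. by rewrite linearZ. Qed.

Let AB z i x y : A z i (x - y) = A z i x - A z i y.
Proof. by rewrite linearB. Qed.

Let sep (z : 'rV[C]_m) (w : 'rV[C]_m) : R := \sum_i nrm (w 0 i - z 0 i).

Let A_ker z w x : kerD T w x -> forall i, A z i x = (w 0 i - z 0 i) *: x.
Proof. by move=> /kerDP hx i; rewrite AE hx scalerBl. Qed.

(** An eigenvector at [w] almost belongs to the kernel at [z]. *)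
Let sum_ker z w x : kerD T w x -> \sum_i nrm (A z i x) = sep z w * nrm x.
Proof.
by move=> hx; rewrite mulr_suml; apply: eq_bigr => i _; rewrite (A_ker z hx) nrmZ.
Qed.

Let A_closed z : D z -> forall y : 'I_m -> H,
  (forall d : R, 0 < d -> exists x, forall i, nrm (A z i x - y i) < d) ->
  exists x, forall i, A z i x = y i.
Proof.
move=> Dz y hy; have cl := cd_closed cd Dz.
have rE x i : Dop T z x 0 i = A z i x by rewrite mxE.
have [|x hx] := closed_range_approx (y := y) cl.
  by move=> d /hy [x hx]; exists x => i; rewrite rE; exact: hx.
by exists x => i; rewrite -rE; exact: hx.
Qed.

Let Ag z : good z -> forall i, A z i (g z) = 0.
Proof. by move=> /gP [kg _] i; rewrite (A_ker z kg) subrr scale0r. Qed.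

Let ge z : good z -> dot (g z) e != 0.
Proof. by move=> /gP [_ ->]; exact: oner_neq0. Qed.

(** The kernel at [z] is spanned by [g z], which is not orthogonal to [e]. *)
Let below z : good z -> exists2 c : R, 0 <= c &
  forall x, dot x e = 0 -> nrm x <= c * \sum_i nrm (A z i x).
Proof.
move=> hz; have [Dz _] := hz.
have hb i : exists k : R, 0 <= k /\ forall x, nrm (T i x) <= k * nrm x.
  by have [k k0 hk] := bounded_nrm (cd_bounded cd i); exists k.
have [k hk] := choice hb.
pose K := \sum_i k i + nrm z.
have k0 i : 0 <= k i by have [] := hk i.
have K0 : 0 <= K by rewrite addr_ge0 ?nrm_ge0 //; apply: sumr_ge0 => i _.
have AK i x : nrm (A z i x) <= K * nrm x.
  rewrite AE (le_trans (nrmB _ _)) // mulrDl nrmZ; apply: lerD.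
    have [_ /(_ x) h] := hk i; rewrite (le_trans h) //.
    apply: ler_wpM2r; first exact: nrm_ge0.
    by rewrite (bigD1 i) //= lerDl; apply: sumr_ge0 => j _.
  by apply: ler_wpM2r; [exact: nrm_ge0|exact: nrm_coord].
have Aker x : (forall i, A z i x = 0) -> dot x e = 0 -> x = 0.
  move=> Ax xe; have kx : kerD T z x.
    by apply/kerDP => i; apply/eqP; rewrite -subr_eq0 -AE Ax.
  have [y y0 yE] := cd_dim1 cd Dz.
  have [kg gE] := gP hz.
  have [a _ ax] : [set c *: y | c in [set: C]] x by rewrite -yE.
  have [b _ bg] : [set c *: y | c in [set: C]] (g z) by rewrite -yE.
  move: xe gE; rewrite -ax -bg !dotZl => /eqP.
  rewrite mulf_eq0 => /orP[/eqP -> _|/eqP ->]; first by rewrite scale0r.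
  by rewrite mulr0 => /eqP; rewrite eq_sym oner_eq0.
exact: (bounded_below ip K0 AK (A_closed Dz) (Ag hz) (ge hz) Aker).
Qed.

Let sep_le z w : sep z w <= m%:R * nrm (w - z).
Proof.
apply: le_trans (sum_nrm_le (w - z)).
by apply: ler_sum => i _; rewrite !mxE.
Qed.

(** An eigenvector at a nearby point that is orthogonal to [e] would violate the
    bound from below. *)
Let good_near z : good z -> exists2 d : R, 0 < d &
  forall w, nrm (w - z) < d -> good w.
Proof.
move=> hz; have [c c0 hc] := below hz; have [Dz _] := hz.
have [d d0 hd] := (nbhs_nrmP z D).1 (open_nbhs_nbhs (conj oD Dz)).
have k0 : 0 < c * m%:R + 1 by rewrite ltr_wpDl ?mulr_ge0.
exists (Num.min d (c * m%:R + 1)^-1); first by rewrite lt_min d0 invr_gt0.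
move=> w; rewrite lt_min => /andP[/hd Dw hw]; split=> //.
have [x x0 xE] := cd_dim1 cd Dw.
have kx : kerD T w x by rewrite xE; exists 1; rewrite ?scale1r.
exists x => //; apply/negP => /eqP xe.
have nx : 0 < nrm x by exact: nrm_gt0.
have := hc x xe; rewrite (sum_ker z kx) mulrA ler_pMl //; apply/negP; rewrite -ltNge.
apply: (@le_lt_trans _ _ (c * (m%:R * nrm (w - z)))); first exact: (ler_wpM2l c0 (sep_le _ _)).
rewrite -(ltr_pM2r k0) mulVf ?gt_eqF // in hw.
have := nrm_ge0 (w - z); nra.
Qed.

(** The difference [g w - g z] is orthogonal to [e] and its image is
    (w - z) [g w]. *)
Let g_lip z : good z -> exists2 c : R, 0 <= c & exists2 d : R, 0 < d &
  forall w, nrm (w - z) < d -> good w /\ nrm (g w - g z) <= c * sep z w.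
Proof.
move=> hz; have [c c0 hc] := below hz; have [d d0 hd] := good_near hz.
have k0 : 0 < 2 * (c * m%:R) + 1 by rewrite ltr_wpDl ?mulr_ge0.
exists (2 * c * nrm (g z)); first by rewrite !mulr_ge0 ?nrm_ge0.
exists (Num.min d (2 * (c * m%:R) + 1)^-1); first by rewrite lt_min d0 invr_gt0.
move=> w; rewrite lt_min => /andP[/hd gw hw]; split=> //.
have [kw we] := gP gw; have [kz ze] := gP hz.
have s0 : 0 <= sep z w by apply: sumr_ge0 => i _; exact: nrm_ge0.
have half : c * sep z w <= 1 / 2.
  apply: (@le_trans _ _ (c * (m%:R * nrm (w - z)))); first exact: (ler_wpM2l c0 (sep_le _ _)).
  rewrite -(ltr_pM2r k0) mulVf ?gt_eqF // in hw.
  have := nrm_ge0 (w - z); nra.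
have h1 : nrm (g w - g z) <= c * (sep z w * nrm (g w)).
  rewrite -(sum_ker z kw); have -> : \sum_i nrm (A z i (g w)) = \sum_i nrm (A z i (g w - g z)).
    by apply: eq_bigr => i _; rewrite linearB Ag // subr0.
  by apply: hc; rewrite dotBl we ze subrr.
have h2 : nrm (g w) <= nrm (g z) + nrm (g w - g z).
  by rewrite -{1}(subrK (g z) (g w)) (le_trans (nrmD _ _)) // addrC.
have h3 := ler_wpM2l (mulr_ge0 c0 s0) h2.
have h4 := ler_wpM2r (nrm_ge0 (g w - g z)) half.
rewrite mulrA in h1; rewrite mulrDr in h3.
have -> : 2 * c * nrm (g z) * sep z w = 2 * (c * sep z w * nrm (g z)) by ring.
by lra.
Qed.

(** The right-hand side is the limit of the images of the difference quotients of
    [g] in the j-th direction; the closed range contains it. *)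
Let partial z j : good z -> exists d, dot d e = 0 /\
  forall i, A z i d = (i == j)%:R *: g z.
Proof.
move=> hz; have [Dz _] := hz.
have [|x xe hx] := complement_preimage (A_closed Dz) (Ag hz) (ge hz)
  (y := fun i => (i == j)%:R *: g z); last by exists x.
move=> d d0; have [c c0 [r r0 hr]] := g_lip hz.
have nj : 0 < nrm ('e_j : 'rV[C]_m) + 1 by rewrite ltr_wpDl ?nrm_ge0.
have c1 : 0 < c + 1 by rewrite ltr_wpDl.
pose t := Num.min (r / (nrm ('e_j : 'rV[C]_m) + 1)) (d / (c + 1)) / 2.
have t0 : 0 < t by rewrite divr_gt0 // lt_min !divr_gt0.
have nt : nrm (t%:C : C) = t by rewrite nrmR gtr0_norm.
have [t1 t2] : t < r / (nrm ('e_j : 'rV[C]_m) + 1) /\ t < d / (c + 1).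
  have : t < Num.min (r / (nrm ('e_j : 'rV[C]_m) + 1)) (d / (c + 1)).
    by rewrite /t ltr_pdivrMr // ltr_pMr ?ltr1n // lt_min !divr_gt0.
  by rewrite lt_min => /andP.
have tC : t%:C != 0 :> C by apply: contraTneq t0 => h; rewrite -nt h nrm0 ltxx.
pose w := z + t%:C *: 'e_j.
have [|gw lw] := hr w.
  rewrite /w addrC addKr nrmZ nt; rewrite ltr_pdivlMr // in t1.
  by apply: le_lt_trans t1; apply: ler_wpM2l; rewrite ?lerDl // ltW.
have [kw _] := gP gw.
have wE i : w 0 i - z 0 i = t%:C * (i == j)%:R.
  by rewrite /w !mxE eqxx /= addrC addKr.
have sE : sep z w = t.
  rewrite /sep (bigD1 j) //= big1 ?addr0; last first.
    by move=> i ij; rewrite wE (negbTE ij) mulr0 nrm0.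
  by rewrite wE eqxx mulr1.
exists (t%:C^-1 *: (g w - g z)) => i.
rewrite AZ AB Ag // subr0 (A_ker z kw) wE !scalerA mulrA mulVf // mul1r.
rewrite -scalerBr nrmZ; apply: (@le_lt_trans _ _ (nrm (g w - g z))).
  rewrite ler_piMl ?nrm_ge0 //; case: (i == j); rewrite ?nrm0 //.
  by rewrite /nrm normr1.
apply: (le_lt_trans lw); rewrite sE; rewrite ltr_pdivlMr // in t2.
by apply: le_lt_trans t2; rewrite mulrC; apply: ler_wpM2l; rewrite ?lerDl // ltW.
Qed.

(** The remainder of the first-order expansion is orthogonal to [e], and its image
    is (w - z) times the increment of [g], which is quadratically small. *)
Let g_diff z : good z -> differentiable g z.
Proof.
move=> hz; have [dj hdj] := choice (fun j => partial j hz).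
have [c c0 hc] := below hz; have [c' c'0 [r r0 hr]] := g_lip hz.
have [kz ze] := gP hz.
suff hd : forall d : R, 0 < d -> exists2 r' : R, 0 < r' &
    forall v, nrm v < r' -> nrm (g (z + v) - g z - lincomb dj v) <= d * nrm v.
  by have [] := differentiable_of_eps (@lincomb_continuous _ _ _ dj) hd.
move=> d d0; pose k := c * c' * m%:R ^+ 2.
have k0 : 0 <= k by rewrite !mulr_ge0 ?exprn_ge0.
have k1 : 0 < k + 1 by rewrite ltr_wpDl.
exists (Num.min r (d / (k + 1))); first by rewrite lt_min r0 divr_gt0.
move=> v; rewrite lt_min => /andP[vr vd].
have [|gw lw] := hr (z + v); first by rewrite addrC addKr.
have [kw we] := gP gw.
have sE : sep z (z + v) = \sum_i nrm (v 0 i).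
  by apply: eq_bigr => i _; rewrite mxE [z 0 i + _]addrC addrK.
set s := sep z (z + v) in sE lw.
have s0 : 0 <= s by rewrite sE; apply: sumr_ge0 => i _; exact: nrm_ge0.
have sv : s <= m%:R * nrm v by rewrite sE sum_nrm_le.
have h1 : nrm (g (z + v) - g z - lincomb dj v) <= c * (s * nrm (g (z + v) - g z)).
  have xe : dot (g (z + v) - g z - lincomb dj v) e = 0.
    rewrite !dotBl we ze subrr sub0r /lincomb dot_suml big1 ?oppr0 //.
    by move=> j _; rewrite dotZl (hdj j).1 mulr0.
  apply: (le_trans (hc _ xe)); apply: ler_wpM2l => //.
  rewrite sE mulr_suml; apply: ler_sum => i _.
  rewrite -nrmZ !AB Ag // subr0 (A_ker z kw) !mxE [z 0 i + _]addrC addrK.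
  have -> : A z i (lincomb dj v) = v 0 i *: g z.
    rewrite /lincomb raddf_sum (bigD1 i) //= big1 ?addr0 => [|j ji].
      by rewrite -[LHS]/(A z i (v 0 i *: dj i)) AZ (hdj i).2 eqxx scale1r.
    rewrite -[LHS]/(A z i (v 0 j *: dj j)) AZ (hdj j).2 eq_sym (negbTE ji).
    by rewrite scale0r scaler0.
  by rewrite scalerBr.
apply: (le_trans h1).
have h2 : nrm (g (z + v) - g z) <= c' * s := lw.
have nv := nrm_ge0 v.
rewrite ltr_pdivlMr // in vd.
apply: (@le_trans _ _ (c * (s * (c' * s)))).
  by apply: ler_wpM2l => //; apply: ler_wpM2l.
apply: (@le_trans _ _ (c * (m%:R * nrm v * (c' * (m%:R * nrm v))))).
  apply: ler_wpM2l => //; apply: ler_pM => //; first exact: mulr_ge0.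
  exact: ler_wpM2l.
have -> : c * (m%:R * nrm v * (c' * (m%:R * nrm v))) = nrm v * k * nrm v.
  by rewrite /k; ring.
apply: ler_wpM2r => //; apply: le_trans (ltW vd).
by apply: ler_wpM2l; rewrite ?lerDl.
Qed.

Lemma holomorphic_section_through w : D w -> kerD T w e -> e != 0 ->
  exists D0 g, holomorphic_section D T D0 g /\ D0 w.
Proof.
move=> Dw ke e0; exists good, g; split; last first.
  split=> //; exists e => //; rewrite (dotxx ip).
  rewrite -(rmorph0 (real_complex R)) (inj_eq (@complexI R)).
  by rewrite expf_neq0 // gt_eqF // nrm_gt0.
split.
- rewrite openE => z /good_near [d d0 hd]; apply/nbhs_nrmP; by exists d.
- by move=> z [].
- exact: g_diff.
- move=> z /gP [_ ge1]; apply/eqP => g0; move: ge1; rewrite g0 dot0l => /eqP.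
  by rewrite eq_sym oner_eq0.
- by move=> z /gP [].
Qed.

End Existence.

(** * Negativity of the curvature *)

Theorem proposition2p1 (R : realType) (H : completeNormedModType R[i])
  (dot : {dot H for Num.conj}) (m : nat) (Omega : set 'rV[R[i]]_m)
  (T : 'I_m -> {linear H -> H}) :
  inner_product dot ->
  separable H ->
  bounded_domain Omega ->
  cowen_douglas1 (conj_set Omega) T ->
  forall w, conj_set Omega w ->
    negative_definite (curvature (conj_set Omega) T w).
Proof.
move=> ip _ [oO _ _ _] cd w Dw.
have oD := conj_set_open oO.
rewrite /curvature; case: xgetP => [K _ [D0 [g [[oD0 sub dg g0 kg] D0w ->]]]|no].
  apply: (negative_definite_of ip oD0 dg g0 D0w) => v v0 a.
  apply: contra v0 => /eqP du; apply/eqP/rowP => i; rewrite mxE.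
  have := derivative_eigen v (cd_bounded cd i) oD0 D0w (dg _ D0w) kg.
  have kw := (kerDP _ _ _).1 (kg _ D0w) i.
  rewrite du linearZ /= kw scalerA mulrC -scalerA -[LHS]addr0 => /addrI /esym /eqP.
  by rewrite scaler_eq0 (negbTE (g0 _ D0w)) orbF => /eqP.
have [e e0 eE] := cd_dim1 cd Dw.
have ke : kerD T w e by rewrite eE; exists 1; rewrite ?scale1r.
have [D0 [g [hg D0w]]] := holomorphic_section_through ip oD cd Dw ke e0.
by case: (no (section_curvature g w)); exists D0, g.
Qed.
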